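(* Let $F$ be a free group and $R$ a normal subgroup of $F$. Put $A=F/RF'$. Then the assignment sending the class of $\tau_m(x,y)$ (where $x,y\in A$, $m$ is a positive integer with $mx=my=0$) to the class of $[a^m,b]$, where $a,b\in F$ are any elements mapping to $x,y$ respectively, induces a natural isomorphism $$A\stackrel{\wedge}{*}A\;\cong\; D_3(F,R)/R'\gamma_3(F).$$
   Context: Notation: $[a,b]=aba^{-1}b^{-1}$; for a group $H$, $\gamma_n(H)$ is the $n$-th term of the lower central series and $H'=\gamma_2(H)$. For a normal subgroup $N$ of a group $E$, with $\mathfrak e$ the augmentation ideal of $\mathbb Z[E]$ and $\mathfrak n$ the augmentation ideal of $\mathbb Z[N]$, the $n$-th relative dimension subgroup is $D_n(E,N)=E\cap(1+\mathfrak n\mathfrak e+\mathfrak e^n)$. For an Abelian group $A$ (written additively), $\mathrm{Tor}(A,A)$ is generated by symbols $\tau_m(x,y)$ ($x,y\in A$, $0<m\in\mathbb Z$, $mx=my=0$) with relations: additivity in $x$ and in $y$ (whenever defined), $\tau_{mn}(x,y)=\tau_m(nx,y)$ if $mnx=my=0$, and $\tau_{mn}(x,y)=\tau_m(x,ny)$ if $mx=mny=0$. The exterior torsion square is $A\stackrel{\wedge}{*}A=\mathrm{Tor}(A,A)/\langle \tau_m(x,x)\mid x\in A,\ mx=0\rangle$. *)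

(* Defs.v *)
(* Groups are (possibly infinite) groupType's and their subgroups are groupClosed
   boolean predicates; asbool makes generated subgroups such predicates. *)
From HB Require Import structures.
From mathcomp Require Import all_boot ssralg ssrint ring_quotient.
From mathcomp Require Import finmap boolp.
From mathcomp.multinomials Require Import monalg.

Set Implicit Arguments.
Unset Strict Implicit.
Unset Printing Implicit Defensive.

Import GRing.Theory.
Local Open Scope ring_scope.
Local Open Scope quotient_scope.

HB.mixin Record isNormalClosed (G : groupType) (S : {pred G}) := {
  gpredJn : forall x g : G, x \in S -> (x ^ g)%g \in S
}.

#[short(type="normalClosed")]
HB.structure Definition NormalClosed (G : groupType) :=
  {S of GroupClosed G S & isNormalClosed G S}.

Section Subgroups.
Variable G : groupType.

(* The convention [a, b] = a b a^-1 b^-1, not MathComp's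
   [~ a, b] = a^-1 b^-1 a b. *)
Definition cmt (a b : G) : G := (a * b * a^-1 * b^-1)%g.

Definition whole : {pred G} := fun=> true.

Fact whole_group : group_closed whole. Proof. by []. Qed.
HB.instance Definition _ := isMulClosed.Build G whole (group_closedM whole_group).
HB.instance Definition _ := isMul1Closed.Build G whole whole_group.1.
HB.instance Definition _ := isInvClosed.Build G whole (group_closedV whole_group).
HB.instance Definition _ := isNormalClosed.Build G whole (fun x g h => h).

Definition gen (S : G -> Prop) : {pred G} := fun x =>
  `[< forall H : {pred G}, group_closed H -> (forall s, S s -> s \in H) ->
      x \in H >].

Lemma gen_sub (S : G -> Prop) s : S s -> s \in gen S.
Proof. by move=> Ss; apply/asboolP => H _; apply. Qed.

Lemma gen_min (S : G -> Prop) (H : {pred G}) :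
  group_closed H -> (forall s, S s -> s \in H) -> {subset gen S <= H}.
Proof. by move=> gH SH x /asboolP; apply. Qed.

Fact gen_group (S : G -> Prop) : group_closed (gen S).
Proof.
split; first by apply/asboolP => H [].
move=> x y /asboolP xS /asboolP yS; apply/asboolP => H gH SH.
by apply: gH.2; [apply: xS|apply: yS].
Qed.

Definition comsub (H K : {pred G}) : {pred G} :=
  gen (fun c => exists a b, [/\ a \in H, b \in K & c = cmt a b]).

(* lcs H n is gamma_n(H) for n >= 1; lcs H 2 is the derived group H'. *)
Definition lcs (H : {pred G}) (n : nat) : {pred G} :=
  iter n.-1 (fun K => comsub K H) H.

Definition mulsub (H K : {pred G}) : {pred G} := fun x =>
  `[< exists h k, [/\ h \in H, k \in K & x = (h * k)%g] >].

Lemma cmtJ (a b g : G) : (cmt a b ^ g = cmt (a ^ g) (b ^ g))%g.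
Proof. by rewrite /cmt !conjMg !conjVg. Qed.

Lemma gen_normal (S : G -> Prop) : (forall s g, S s -> S (s ^ g)%g) ->
  forall x g, x \in gen S -> (x ^ g)%g \in gen S.
Proof.
move=> SJ x g; pose H : {pred G} := fun x => (x ^ g)%g \in gen S.
apply: (@gen_min S H) => [|s Ss]; last exact/gen_sub/SJ.
split; first by rewrite unfold_in /H conj1g; apply: (gen_group S).1.
move=> u v; rewrite !unfold_in /H conjMg conjVg => uH vH.
exact: (gen_group S).2.
Qed.

Fact lcs_group (H : groupClosed G) n : group_closed (lcs H n).
Proof.
case: n => [|[|n]] /=; last exact: gen_group;
  by split; [exact: gpred1|exact: gpredF].
Qed.

Fact lcs_normal (H : normalClosed G) n x g :
  x \in lcs H n -> (x ^ g)%g \in lcs H n.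
Proof.
rewrite /lcs; elim: n.-1 x g => [|m IHm] x g /=; first exact: gpredJn.
apply: gen_normal => s h [a [b [aH bH ->]]].
by exists (a ^ h)%g, (b ^ h)%g; split; [exact: IHm|exact: gpredJn|exact: cmtJ].
Qed.

Fact mulsub_group (H : groupClosed G) (K : normalClosed G) :
  group_closed (mulsub H K).
Proof.
split.
  by apply/asboolP; exists 1%g, 1%g; split; rewrite ?gpred1 ?mulg1.
move=> x y /asboolP[h [k [hH kK ->]]] /asboolP[h' [k' [hH' kK' ->]]].
apply/asboolP; exists (h / h')%g, ((k / k') ^ (h'^-1))%g; split.
- exact: gpredF.
- by apply: gpredJn; apply: gpredF.
- by rewrite conjgE invgK !invgM !mulgA mulgVK.
Qed.

Fact mulsub_normal (H K : normalClosed G) x g :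
  x \in mulsub H K -> (x ^ g)%g \in mulsub H K.
Proof.
move=> /asboolP[h [k [hH kK ->]]]; apply/asboolP.
by exists (h ^ g)%g, (k ^ g)%g; split; rewrite ?conjMg ?gpredJn.
Qed.

End Subgroups.

HB.instance Definition _ G (H : groupClosed G) n :=
  isMulClosed.Build G (lcs H n) (group_closedM (lcs_group H n)).
HB.instance Definition _ G (H : groupClosed G) n :=
  isMul1Closed.Build G (lcs H n) (lcs_group H n).1.
HB.instance Definition _ G (H : groupClosed G) n :=
  isInvClosed.Build G (lcs H n) (group_closedV (lcs_group H n)).
HB.instance Definition _ G (H : normalClosed G) n :=
  isNormalClosed.Build G (lcs H n) (@lcs_normal G H n).

HB.instance Definition _ G (H : groupClosed G) (K : normalClosed G) :=
  isMulClosed.Build G (mulsub H K) (group_closedM (mulsub_group H K)).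
HB.instance Definition _ G (H : groupClosed G) (K : normalClosed G) :=
  isMul1Closed.Build G (mulsub H K) (mulsub_group H K).1.
HB.instance Definition _ G (H : groupClosed G) (K : normalClosed G) :=
  isInvClosed.Build G (mulsub H K) (group_closedV (mulsub_group H K)).
HB.instance Definition _ G (H K : normalClosed G) :=
  isNormalClosed.Build G (mulsub H K) (@mulsub_normal G H K).

Arguments whole {G}.
Arguments whole : simpl never.

Definition free_on (F : groupType) (X : F -> Prop) : Prop :=
  forall (G : groupType) (f : F -> G),
  exists2 phi : {multiplicative F -> G}, (forall x, X x -> phi x = f x) &
    forall psi : {multiplicative F -> G},
      (forall x, X x -> psi x = f x) -> psi =1 phi.

Definition free_group (F : groupType) : Prop := exists X, @free_on F X.

Section GroupQuotient.
Variables (G : groupType) (N : normalClosed G).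

Definition gequiv (x y : G) := (x^-1 * y)%g \in N.

Fact gequiv_is_equiv : equiv_class_of gequiv.
Proof.
split=> [x|x y|y x z]; rewrite /gequiv.
- by rewrite mulVg gpred1.
- by rewrite -(gpredV N (x^-1 * y)%g) invgM invgK.
- by move=> xy yz; rewrite -[x^-1%g](mulgK y) -mulgA gpredM.
Qed.

Canonical gequiv_equiv := EquivRelPack gequiv_is_equiv.
Canonical gequiv_encModRel := defaultEncModRel gequiv.

Definition gquot := {eq_quot gequiv}.

HB.instance Definition _ : EqQuotient G gequiv gquot := EqQuotient.on gquot.
HB.instance Definition _ := Choice.on gquot.

Definition coset (x : G) : gquot := \pi_gquot x.

Lemma coset_eq x y : (coset x == coset y) = ((x^-1 * y)%g \in N).
Proof. by rewrite /coset piE. Qed.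

Lemma repr_coset x : (x^-1 * repr (coset x))%g \in N.
Proof. by rewrite -coset_eq /coset reprK. Qed.

Lemma cosetP (q : gquot) : exists x, q = coset x.
Proof. by exists (repr q); rewrite /coset reprK. Qed.

Definition gq_one : gquot := coset 1.
Definition gq_mul (p q : gquot) : gquot := coset (repr p * repr q).
Definition gq_inv (p : gquot) : gquot := coset (repr p)^-1.

Lemma gq_mulE x y : gq_mul (coset x) (coset y) = coset (x * y)%g.
Proof.
apply/esym/eqP; rewrite coset_eq invgM.
have := repr_coset x; have := repr_coset y.
move: (repr (coset x)) (repr (coset y)) => x' y' Ny Nx.
have -> : (y^-1 * x^-1 * (x' * y') = (x^-1 * x') ^ y * (y^-1 * y'))%g.
  by rewrite conjgE !mulgA mulgK.
by apply: gpredM => //; apply: gpredJn.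
Qed.

Lemma gq_invE x : gq_inv (coset x) = coset x^-1.
Proof.
apply/esym/eqP; rewrite coset_eq invgK.
have := repr_coset x; move: (repr (coset x)) => x' Nx.
have -> : (x * x'^-1 = ((x^-1 * x')^-1) ^ (x^-1))%g.
  by rewrite conjgE !invgM !invgK !mulgA mulgK.
by apply: gpredJn; rewrite gpredV.
Qed.

Fact gq_mulA : associative gq_mul.
Proof.
move=> p q r; have [x ->] := cosetP p; have [y ->] := cosetP q.
by have [z ->] := cosetP r; rewrite !gq_mulE mulgA.
Qed.

Fact gq_mul1 : left_id gq_one gq_mul.
Proof. by move=> p; have [x ->] := cosetP p; rewrite gq_mulE mul1g. Qed.

Fact gq_mulr1 : right_id gq_one gq_mul.
Proof. by move=> p; have [x ->] := cosetP p; rewrite gq_mulE mulg1. Qed.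

Fact gq_mulV : left_inverse gq_one gq_inv gq_mul.
Proof. by move=> p; have [x ->] := cosetP p; rewrite gq_invE gq_mulE mulVg. Qed.

Fact gq_mulrV : right_inverse gq_one gq_inv gq_mul.
Proof. by move=> p; have [x ->] := cosetP p; rewrite gq_invE gq_mulE mulgV. Qed.

HB.instance Definition _ :=
  isGroup.Build gquot gq_mulA gq_mul1 gq_mulr1 gq_mulV gq_mulrV.

Fact coset_gmulfM : {morph coset : x y / (x * y)%g}.
Proof. by move=> x y; rewrite -gq_mulE. Qed.
HB.instance Definition _ := monoid.isMultiplicative.Build G gquot coset coset_gmulfM.

End GroupQuotient.

Arguments gquot {G} N.
Arguments coset {G} N x.

(* F / R F' with additive notation; on gquot the same law is multiplicative. *)
Definition relab (F : groupType) (R : normalClosed F) :=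
  gquot (mulsub R (lcs whole 2)).

Section RelAb.
Variables (F : groupType) (R : normalClosed F).

HB.instance Definition _ := Choice.on (relab R).

Definition abcl (a : F) : relab R := coset _ a.

Lemma abcl_eq a b : (abcl a = abcl b) <-> (a^-1 * b)%g \in mulsub R (lcs whole 2).
Proof.
by split=> [/eqP|ab]; [|apply/eqP]; rewrite /abcl coset_eq.
Qed.

Definition ra_add (p q : relab R) : relab R := (p * q : gquot _)%g.
Definition ra_opp (p : relab R) : relab R := (p^-1 : gquot _)%g.

Fact ra_addA : associative ra_add. Proof. exact: mulgA. Qed.
Fact ra_add0 : left_id (abcl 1) ra_add. Proof. exact: mul1g. Qed.
Fact ra_addN : left_inverse (abcl 1) ra_opp ra_add. Proof. exact: mulVg. Qed.
Fact ra_addC : commutative ra_add.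
Proof.
move=> p q; have [x ->] := cosetP p; have [y ->] := cosetP q.
rewrite /ra_add -!coset_gmulfM; apply/eqP; rewrite coset_eq invgM.
apply/asboolP; exists 1%g, (cmt y^-1 x^-1)%g; split; first exact: gpred1.
  by apply: gen_sub; exists y^-1%g, x^-1%g.
by rewrite /cmt !invgK mul1g !mulgA.
Qed.

HB.instance Definition _ :=
  GRing.isZmodule.Build (relab R) ra_addA ra_addC ra_add0 ra_addN.

Lemma abclM a b : abcl (a * b)%g = abcl a + abcl b.
Proof. exact: (coset_gmulfM _ a b). Qed.

Lemma abclP (x : relab R) : exists a, x = abcl a.
Proof. exact: cosetP. Qed.

End RelAb.

Arguments abcl {F} R a.

Section SubType.
Variables (G : groupType) (H : groupClosed G).

Record gsub := GSub { gval : G; _ : gval \in H }.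

HB.instance Definition _ := [isSub for gval].
HB.instance Definition _ := [Choice of gsub by <:].

Fact gsub_closed : group_closed (fun x => x \in H).
Proof. by split; [exact: gpred1|exact: gpredF]. Qed.

HB.instance Definition _ := SubChoice_isSubGroup.Build G (fun x => x \in H) gsub gsub_closed.

Lemma gvalP (x : gsub) : gval x \in H. Proof. by case: x. Qed.
Lemma gval1 : gval 1%g = 1%g. Proof. exact: (val1 gsub). Qed.
Lemma gvalM x y : gval (x * y)%g = (gval x * gval y)%g.
Proof. exact: (valM (x : gsub)). Qed.
Lemma gvalV x : gval x^-1%g = (gval x)^-1%g.
Proof. by apply: (@mulgI G (gval x)); rewrite -gvalM !mulgV gval1. Qed.

End SubType.

Section SubQuotient.
Variables (G : groupType) (H : groupClosed G).

Definition relsub (N : {pred G}) : {pred gsub H} := fun x => gval x \in N.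

Lemma relsubE N x : (x \in relsub N) = (gval x \in N). Proof. by []. Qed.

Variable N : normalClosed G.

Fact relsub_group : group_closed (relsub N).
Proof.
split; first by rewrite relsubE gval1 gpred1.
move=> x y; rewrite !relsubE gvalM gvalV => xN yN.
exact: gpredF.
Qed.

Fact relsub_normal x g : x \in relsub N -> (x ^ g)%g \in relsub N.
Proof.
rewrite !relsubE conjgE !gvalM gvalV => xN.
exact: (gpredJn (gval x) (gval g)).
Qed.

HB.instance Definition _ :=
  isMulClosed.Build (gsub H) (relsub N) (group_closedM relsub_group).
HB.instance Definition _ :=
  isMul1Closed.Build (gsub H) (relsub N) relsub_group.1.
HB.instance Definition _ :=
  isInvClosed.Build (gsub H) (relsub N) (group_closedV relsub_group).
HB.instance Definition _ :=
  isNormalClosed.Build (gsub H) (relsub N) relsub_normal.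

(* The quotient H / N when N is contained in H (H / (H :&: N) in general). *)
Definition subquo := gquot (relsub N).
HB.instance Definition _ := monoid.Group.on subquo.

Definition sqcl (x : gsub H) : subquo := coset _ x.

Lemma sqcl_eq x y : (sqcl x = sqcl y) <-> ((gval x)^-1 * gval y)%g \in N.
Proof.
rewrite -gvalV -gvalM; split=> [/eqP|xy]; [|apply/eqP];
  by rewrite /sqcl coset_eq.
Qed.

End SubQuotient.

Arguments subquo {G} H N.
Arguments sqcl {G H} N x.

Section FreeAbelian.
Variable K : choiceType.

Definition mlift (V : zmodType) (f : K -> V) (u : {malg int[K]}) : V :=
  \sum_(k <- msupp u) f k *~ u@_k.

Lemma mliftw (V : zmodType) (f : K -> V) (u : {malg int[K]}) (d : {fset K}) :
  (msupp u `<=` d)%fset -> mlift f u = \sum_(k <- d) f k *~ u@_k.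
Proof.
move=> ud; rewrite /mlift (big_fset_incl _ ud) //= => k _.
by move=> /mcoeff_outdom ->; rewrite mulr0z.
Qed.

Fact mlift_zmod (V : zmodType) (f : K -> V) : zmod_morphism (mlift f).
Proof.
move=> u v; pose d := (msupp u `|` msupp v)%fset.
rewrite (mliftw f (msuppB_le u v : _ `<=` d)%fset).
rewrite (mliftw f (fsubsetUl _ _ : _ `<=` d)%fset).
rewrite (mliftw f (fsubsetUr _ _ : _ `<=` d)%fset) -sumrB.
by apply: eq_bigr => k _; rewrite mcoeffB mulrzBr.
Qed.
HB.instance Definition _ (V : zmodType) (f : K -> V) :=
  GRing.isZmodMorphism.Build {malg int[K]} V (mlift f) (mlift_zmod f).

Lemma mliftU (V : zmodType) (f : K -> V) k : mlift f << k >> = f k.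
Proof. by rewrite (mliftw f msuppU_le) big_seq_fset1 mcoeffUU. Qed.

Lemma malg_sumE (u : {malg int[K]}) :
  u = \sum_(k <- msupp u) (<< k >> : {malg int[K]}) *~ u@_k.
Proof.
rewrite {1}[u]monalgE; apply: eq_bigr => k _.
by rewrite -[in LHS](intz u@_k) raddfMz.
Qed.

Lemma mlift_uniq (V : zmodType) (f g : {additive {malg int[K]} -> V}) :
  (forall k, f << k >> = g << k >>) -> f =1 g.
Proof.
move=> fg u; rewrite [u]malg_sumE !raddf_sum; apply: eq_bigr => k _.
by rewrite !raddfMz fg.
Qed.

End FreeAbelian.

Definition gring (G : groupType) := {malg int[G]}.

Section GroupRing.
Variable G : groupType.

HB.instance Definition _ := GRing.Zmodule.on (gring G).

Implicit Types (u v w : gring G) (g h : G).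

Definition gelt g : gring G := << g >>.

Definition gr_mul u v : gring G :=
  \sum_(g <- msupp u) \sum_(h <- msupp v) << u@_g * v@_h *g (g * h)%g >>.

Lemma gr_mulE u v :
  gr_mul u v = mlift (fun g => mlift (fun h => gelt (g * h)%g) v) u.
Proof.
apply: eq_bigr => g _; rewrite /mlift mulrz_suml; apply: eq_bigr => h _.
rewrite -mulrzA mulrC -[in LHS](intz (_ * _)) raddfMz /=.
by [].
Qed.

Lemma gr_mulDl : left_distributive gr_mul +%R.
Proof. by move=> u v w; rewrite !gr_mulE raddfD. Qed.

Lemma gr_mulDr : right_distributive gr_mul +%R.
Proof.
move=> u v w; rewrite !gr_mulE /mlift -big_split; apply: eq_bigr => g _ /=.
by rewrite -mulrzDl; congr (_ *~ _); apply: (raddfD (mlift _)).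
Qed.

Fact gr_mul_zmodl v : zmod_morphism (gr_mul^~ v).
Proof. by move=> u w; rewrite !gr_mulE raddfB. Qed.
Fact gr_mul_zmodr u : zmod_morphism (gr_mul u).
Proof.
move=> v w; rewrite !gr_mulE /mlift -sumrB; apply: eq_bigr => g _ /=.
by rewrite -mulrzBl; congr (_ *~ _); apply: (raddfB (mlift _)).
Qed.

Let mull v := HB.pack_for {additive gring G -> gring G} (gr_mul^~ v)
  (GRing.isZmodMorphism.Build (gring G) (gring G) _ (gr_mul_zmodl v)).
Let mulr_ u := HB.pack_for {additive gring G -> gring G} (gr_mul u)
  (GRing.isZmodMorphism.Build (gring G) (gring G) _ (gr_mul_zmodr u)).

Lemma gr_mulU g h : gr_mul (gelt g) (gelt h) = gelt (g * h)%g.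
Proof. by rewrite gr_mulE !mliftU. Qed.

Fact gr_mulA : associative gr_mul.
Proof.
move=> u v w.
apply: (mlift_uniq (f := mull (gr_mul v w)) (g := mull w \o mull v)) u => g /=.
apply: (mlift_uniq (f := mulr_ (gelt g) \o mull w)
                   (g := mull w \o mulr_ (gelt g))) v => h /=.
apply: (mlift_uniq (f := mulr_ (gelt g) \o mulr_ (gelt h))
                   (g := mulr_ (gr_mul (gelt g) (gelt h)))) w => k /=.
by rewrite -/(gelt k) !gr_mulU mulgA.
Qed.

Fact gr_mul1 : left_id (gelt 1) gr_mul.
Proof.
move=> u; apply: (mlift_uniq (f := mulr_ (gelt 1)) (g := idfun)) u => g /=.
by rewrite gr_mulU mul1g.
Qed.

Fact gr_mulr1 : right_id (gelt 1) gr_mul.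
Proof.
move=> u; apply: (mlift_uniq (f := mull (gelt 1)) (g := idfun)) u => g /=.
by rewrite gr_mulU mulg1.
Qed.

Fact gr_one_neq0 : gelt 1 != 0.
Proof. by rewrite monalgU_eq0. Qed.

HB.instance Definition _ := GRing.Zmodule_isNzRing.Build (gring G)
  gr_mulA gr_mul1 gr_mulr1 gr_mulDl gr_mulDr gr_one_neq0.

Lemma geltM g h : gelt (g * h)%g = gelt g * gelt h.
Proof. by rewrite -gr_mulU. Qed.

Lemma gelt1 : gelt 1%g = 1. Proof. by []. Qed.

Lemma gring_add_eq (V : zmodType) (f g : {additive gring G -> V}) :
  (forall x, f (gelt x) = g (gelt x)) -> f =1 g.
Proof. exact: mlift_uniq. Qed.

End GroupRing.

Definition gring_map (G H : groupType) (phi : G -> H) : gring G -> gring H :=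
  mlift (fun g => gelt (phi g)).

Section MultLift.
Variable G : groupType.

Lemma gring_eq (V : zmodType) (f g : gring G -> V) :
  zmod_morphism f -> zmod_morphism g ->
  (forall x, f (gelt x) = g (gelt x)) -> f =1 g.
Proof.
move=> fB gB.
pose fA := HB.pack_for {additive gring G -> V} f
  (GRing.isZmodMorphism.Build (gring G) V f fB).
pose gA := HB.pack_for {additive gring G -> V} g
  (GRing.isZmodMorphism.Build (gring G) V g gB).
exact: (@gring_add_eq G V fA gA).
Qed.

Lemma mlift_mul (R : nzRingType) (f : G -> R) :
  (forall g h, f (g * h)%g = f g * f h) ->
  forall u v : gring G, mlift f (u * v) = mlift f u * mlift f v.
Proof.
move=> fM u v.
apply: (gring_eq (f := fun u => mlift f (u * v))
                 (g := fun u => mlift f u * mlift f v)) u => [u w|u w|g].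
- by rewrite mulrBl; apply: (raddfB (mlift f)).
- by rewrite -mulrBl; congr (_ * _); apply: (raddfB (mlift f)).
apply: (gring_eq (f := fun v => mlift f (gelt g * v))
                 (g := fun v => mlift f (gelt g) * mlift f v)) v => [v w|v w|h].
- by rewrite mulrBr; apply: (raddfB (mlift f)).
- by rewrite -mulrBr; congr (_ * _); apply: (raddfB (mlift f)).
by rewrite -geltM !mliftU.
Qed.

End MultLift.

Section GroupRingMap.
Variables (G H : groupType) (phi : {multiplicative G -> H}).

Fact gring_map_zmod : zmod_morphism (gring_map phi).
Proof. exact: mlift_zmod. Qed.

Lemma gring_mapU g : gring_map phi (gelt g) = gelt (phi g).
Proof. exact: mliftU. Qed.

Lemma gring_mapM u v :
  gring_map phi (u * v) = gring_map phi u * gring_map phi v.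
Proof. by apply: mlift_mul => g h; rewrite gmulfM geltM. Qed.

End GroupRingMap.

Section Span.
Variable V : zmodType.

Definition zspan (S : V -> Prop) : {pred V} := fun v =>
  `[< forall H : {pred V}, GRing.zmod_closed H -> (forall s, S s -> s \in H) ->
      v \in H >].

Lemma zspan_sub (S : V -> Prop) s : S s -> s \in zspan S.
Proof. by move=> Ss; apply/asboolP => H _; apply. Qed.

Lemma zspan_min (S : V -> Prop) (H : {pred V}) :
  GRing.zmod_closed H -> (forall s, S s -> s \in H) -> {subset zspan S <= H}.
Proof. by move=> gH SH x /asboolP; apply. Qed.

Fact zspan_closed (S : V -> Prop) : GRing.zmod_closed (zspan S).
Proof.
split; first by apply/asboolP => H [].
move=> x y /asboolP xS /asboolP yS; apply/asboolP => H gH SH.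
by apply: gH.2; [apply: xS|apply: yS].
Qed.

HB.instance Definition _ (S : V -> Prop) :=
  GRing.isZmodClosed.Build V (zspan S) (zspan_closed S).

Definition addsub (I J : {pred V}) : {pred V} := fun w =>
  `[< exists u v, [/\ u \in I, v \in J & w = u + v] >].

Fact addsub_closed (I J : {pred V}) : GRing.zmod_closed I ->
  GRing.zmod_closed J -> GRing.zmod_closed (addsub I J).
Proof.
move=> [I0 IB] [J0 JB]; split.
  by apply/asboolP; exists 0, 0; rewrite addr0.
move=> x y /asboolP[u [v [uI vJ ->]]] /asboolP[u' [v' [uI' vJ' ->]]].
apply/asboolP; exists (u - u'), (v - v'); split; [exact: IB|exact: JB|].
by rewrite opprD addrACA.
Qed.

End Span.

Lemma zspan_map (V W : zmodType) (f : V -> W) (S : V -> Prop) (H : {pred W}) :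
  zmod_morphism f -> GRing.zmod_closed H -> (forall s, S s -> f s \in H) ->
  forall v, v \in zspan S -> f v \in H.
Proof.
move=> fB [H0 HB] SH v; pose K : {pred V} := fun v => f v \in H.
apply: (@zspan_min V S K) => //; split.
  by have := fB 0 0; rewrite !subrr /K unfold_in => ->.
by move=> x y; rewrite !unfold_in /K fB; apply: HB.
Qed.

Definition mulideal (R : nzRingType) (I J : {pred R}) : {pred R} :=
  zspan (fun w => exists u v, [/\ u \in I, v \in J & w = u * v]).

Definition expideal (R : nzRingType) (I : {pred R}) (n : nat) : {pred R} :=
  if n is m.+1 then iter m (fun J => mulideal J I) I else predT.

Section RelativeDimension.
Variable E : groupType.

Definition augmentation (u : gring E) : int := \sum_(g <- msupp u) u@_g.

(* The image in Z[E] of the augmentation ideal of Z[N]: the elements supported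
   in N and of augmentation 0 (not the ideal of Z[E] they generate). *)
Definition augid (N : {pred E}) : {pred gring E} := fun u =>
  `[< (forall g, g \notin N -> u@_g = 0) /\ augmentation u = 0 >].

(* D_n(E, N) *)
Definition reldim (N : {pred E}) (n : nat) : {pred E} := fun g =>
  gelt g - 1 \in
    addsub (mulideal (augid N) (augid whole)) (expideal (augid whole) n).

Lemma augmentationE u : augmentation u = mlift (fun=> 1) u.
Proof. by apply: eq_bigr => g _; rewrite intz. Qed.

Lemma augB : zmod_morphism augmentation.
Proof. by move=> u v; rewrite !augmentationE; apply: (raddfB (mlift _)). Qed.

Lemma augU g : augmentation (gelt g) = 1.
Proof. by rewrite augmentationE mliftU. Qed.

Lemma augM u v : augmentation (u * v) = augmentation u * augmentation v.
Proof. by rewrite !augmentationE mlift_mul // => g h; rewrite mulr1. Qed.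

Lemma augid_closed (N : {pred E}) : GRing.zmod_closed (augid N).
Proof.
split.
  apply/asboolP; split=> [g _|]; first exact: mcoeff0.
  by have := augB 0 0; rewrite !subrr.
move=> u v /asboolP[uN u0] /asboolP[vN v0]; apply/asboolP.
split=> [g gN|]; last by rewrite augB u0 v0 subrr.
by rewrite mcoeffB uN // vN // subrr.
Qed.

Lemma whole_augid u : (u \in augid whole) = (augmentation u == 0).
Proof. by apply/asboolP/eqP => [[]|u0]. Qed.

Lemma augid_sub1 (N : groupClosed E) g : g \in N -> gelt g - 1 \in augid N.
Proof.
move=> gN; apply/asboolP; split=> [h hN|]; last by rewrite augB !augU subrr.
rewrite mcoeffB !mcoeffU.
case: eqP => [gh|_]; first by rewrite -gh gN in hN.
case: eqP => [h1|_]; first by rewrite -h1 gpred1 in hN.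
by rewrite !mulr0n subrr.
Qed.

Definition rideal (I : {pred gring E}) := forall u v, u \in I -> u * v \in I.

Lemma rideal_whole : rideal (augid whole).
Proof. by move=> u v; rewrite !whole_augid augM => /eqP ->; rewrite mul0r. Qed.

Lemma rideal_mul I J : rideal J -> rideal (mulideal I J).
Proof.
move=> rJ u v; apply: (@zspan_map _ _ (fun u => u * v)).
- by move=> x y; rewrite mulrBl.
- exact: zspan_closed.
move=> _ [a [b [aI bJ ->]]]; rewrite -mulrA; apply: zspan_sub.
by exists a, (b * v); split=> //; apply: rJ.
Qed.

Lemma rideal_exp n : rideal (expideal (augid whole) n).
Proof.
case: n => [|n] //=; elim: n => [|n IHn] /=; first exact: rideal_whole.
exact/rideal_mul/rideal_whole.
Qed.

Lemma exp_closed n : GRing.zmod_closed (expideal (augid whole) n).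
Proof.
case: n => [|[|n]] //=; last exact: zspan_closed.
exact: augid_closed.
Qed.

Lemma rideal_add I J : rideal I -> rideal J -> rideal (addsub I J).
Proof.
move=> rI rJ _ v /asboolP[a [b [aI bJ ->]]]; apply/asboolP.
by exists (a * v), (b * v); rewrite mulrDl; split=> //; [exact: rI|exact: rJ].
Qed.

Lemma rideal_group (I : {pred gring E}) : GRing.zmod_closed I -> rideal I ->
  group_closed (fun g => gelt g - 1 \in I).
Proof.
move=> [I0 IB] rI; split; first by rewrite unfold_in gelt1 subrr.
move=> g h; rewrite !unfold_in => gI hI.
have -> : gelt (g * h^-1)%g - 1 = ((gelt g - 1) - (gelt h - 1)) * gelt h^-1%g.
  by rewrite opprB addrA subrK mulrBl -!geltM mulgV gelt1.
by apply: rI; apply: IB.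
Qed.

Fact reldim_group (N : {pred E}) n : group_closed (reldim N n).
Proof.
apply: rideal_group.
  by apply: addsub_closed; [exact: zspan_closed|exact: exp_closed].
by apply: rideal_add; [apply/rideal_mul/rideal_whole|exact: rideal_exp].
Qed.

HB.instance Definition _ (N : {pred E}) n :=
  isMulClosed.Build E (reldim N n) (group_closedM (reldim_group N n)).
HB.instance Definition _ (N : {pred E}) n :=
  isMul1Closed.Build E (reldim N n) (reldim_group N n).1.
HB.instance Definition _ (N : {pred E}) n :=
  isInvClosed.Build E (reldim N n) (group_closedV (reldim_group N n)).

End RelativeDimension.

(* sub_reldim3 below makes dimquo a genuine quotient. *)
Section Containment.
Variables (F : groupType) (R : groupClosed F).

Local Notation f := (augid (@whole F)).

Lemma gelt_cmt (a b : F) : gelt (cmt a b) - 1 =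
  ((gelt a - 1) * (gelt b - 1) - (gelt b - 1) * (gelt a - 1)) *
  gelt (a^-1 * b^-1)%g.
Proof.
have -> : (gelt a - 1) * (gelt b - 1) - (gelt b - 1) * (gelt a - 1) =
  gelt (a * b)%g - gelt (b * a)%g.
  have P (x y : gring F) : (x - 1) * (y - 1) = x * y - (x + y - 1).
    rewrite mulrBr mulr1 mulrBl mul1r !opprB opprD -addrA; congr (_ + _).
    by rewrite addrC -addrA.
  rewrite !P !geltM (addrC (gelt b)); set s := _ - 1.
  by rewrite [- (_ - s)]opprB addrA subrK.
rewrite mulrBl -!geltM; congr (_ - _).
  by rewrite /cmt !mulgA.
by rewrite !mulgA mulgK mulgV gelt1.
Qed.

Lemma mulideal_in (I J : {pred gring F}) u v :
  u \in I -> v \in J -> u * v \in mulideal I J.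
Proof. by move=> uI vJ; apply: zspan_sub; exists u, v. Qed.

Lemma lcs2_sub a : a \in lcs whole 2 -> gelt a - 1 \in mulideal f f.
Proof.
apply: (@gen_min F _ (fun a => gelt a - 1 \in mulideal f f)).
  by apply: rideal_group; [exact: zspan_closed|exact/rideal_mul/rideal_whole].
move=> _ [b [c [_ _ ->]]]; rewrite unfold_in gelt_cmt.
apply: (rideal_mul (@rideal_whole F)); apply: (zspan_closed _).2.
  by apply: mulideal_in; apply: augid_sub1.
by apply: mulideal_in; apply: augid_sub1.
Qed.

Lemma lcs3_sub a : a \in lcs whole 3 -> gelt a - 1 \in expideal f 3.
Proof.
apply: (@gen_min F _ (fun a => gelt a - 1 \in expideal f 3)).
  by apply: rideal_group; [exact: exp_closed|exact: rideal_exp].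
move=> _ [b [c [b2 _ ->]]]; rewrite unfold_in gelt_cmt.
apply: (@rideal_exp F 3); apply: (exp_closed F 3).2.
  by apply: mulideal_in; [exact: lcs2_sub|exact: augid_sub1].
have cf : gelt c - 1 \in f by exact: augid_sub1.
apply: (@zspan_map _ _ (fun u => (gelt c - 1) * u)) (lcs2_sub b2).
- by move=> x y; rewrite mulrBr.
- exact: zspan_closed.
move=> _ [u [v [uf vf ->]]]; rewrite mulrA.
by apply: mulideal_in => //; apply: mulideal_in.
Qed.

Lemma der_sub a : a \in lcs R 2 -> gelt a - 1 \in mulideal (augid R) f.
Proof.
apply: (@gen_min F _ (fun a => gelt a - 1 \in mulideal (augid R) f)).
  by apply: rideal_group; [exact: zspan_closed|exact/rideal_mul/rideal_whole].
move=> _ [b [c [bR cR ->]]]; rewrite unfold_in gelt_cmt.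
apply: (rideal_mul (@rideal_whole F)); apply: (zspan_closed _).2.
  by apply: mulideal_in; apply: augid_sub1.
by apply: mulideal_in; apply: augid_sub1.
Qed.

Lemma sub_reldim3 :
  {subset mulsub (lcs R 2) (lcs whole 3) <= reldim R 3}.
Proof.
move=> _ /asboolP[a [b [aR bF ->]]]; apply: gpredM.
  apply/asboolP; exists (gelt a - 1), 0; rewrite addr0; split=> //.
    exact: der_sub.
  exact: (exp_closed F 3).1.
apply/asboolP; exists 0, (gelt b - 1); rewrite add0r; split=> //.
  exact: (zspan_closed _).1.
exact: lcs3_sub.
Qed.

End Containment.

Definition dimquo (F : groupType) (R : normalClosed F) :=
  subquo (reldim R 3) (mulsub (lcs R 2) (lcs whole 3)).
HB.instance Definition _ (F : groupType) (R : normalClosed F) :=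
  monoid.Group.on (dimquo R).

Definition dimcl (F : groupType) (R : normalClosed F)
    (d : gsub (reldim R 3)) : dimquo R := sqcl _ d.

Section Torsion.
Variable A : zmodType.

Definition torgen_pred (t : nat * A * A) : bool :=
  let: (m, x, y) := t in [&& (0 < m)%N, x *+ m == 0 & y *+ m == 0].

Definition torgen := {t : nat * A * A | torgen_pred t}.

(* Junk value 0 off torgen_pred; torrel only uses tsym under torgen_pred. *)
Definition tsym (m : nat) (x y : A) : {malg int[torgen]} :=
  if insub (m, x, y) is Some t then << t >> else 0.

Inductive torrel : {malg int[torgen]} -> Prop :=
| TorAddl m x x' y : (0 < m)%N -> x *+ m = 0 -> x' *+ m = 0 -> y *+ m = 0 ->
    torrel (tsym m (x + x') y - (tsym m x y + tsym m x' y))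
| TorAddr m x y y' : (0 < m)%N -> x *+ m = 0 -> y *+ m = 0 -> y' *+ m = 0 ->
    torrel (tsym m x (y + y') - (tsym m x y + tsym m x y'))
| TorMull m n x y : (0 < m)%N -> (0 < n)%N ->
    x *+ (m * n) = 0 -> y *+ m = 0 ->
    torrel (tsym (m * n) x y - tsym m (x *+ n) y)
| TorMulr m n x y : (0 < m)%N -> (0 < n)%N ->
    x *+ m = 0 -> y *+ (m * n) = 0 ->
    torrel (tsym (m * n) x y - tsym m x (y *+ n)).

Definition Tor := Quotient.quot (zspan torrel).
HB.instance Definition _ := GRing.Zmodule.on Tor.

Definition torcl (u : {malg int[torgen]}) : Tor := \pi_Tor u.
Definition tau (m : nat) (x y : A) : Tor := torcl (tsym m x y).

Definition taudiag (t : Tor) : Prop :=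
  exists m x, [/\ (0 < m)%N, x *+ m = 0 & t = tau m x x].

Definition extTor := Quotient.quot (zspan taudiag).
HB.instance Definition _ := GRing.Zmodule.on extTor.

Definition extcl (t : Tor) : extTor := \pi_extTor t.

Lemma torcl_eq u v : (torcl u == torcl v) = (u - v \in zspan torrel).
Proof. by rewrite -Quotient.equivE /torcl piE. Qed.

Lemma extcl_eq s t : (extcl s == extcl t) = (s - t \in zspan taudiag).
Proof. by rewrite -Quotient.equivE /extcl piE. Qed.

Fact torcl_zmod : zmod_morphism torcl. Proof. exact: raddfB. Qed.
HB.instance Definition _ := GRing.isZmodMorphism.Build _ Tor torcl torcl_zmod.
Fact extcl_zmod : zmod_morphism extcl. Proof. exact: raddfB. Qed.
HB.instance Definition _ := GRing.isZmodMorphism.Build Tor extTor extcl extcl_zmod.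

Lemma torclP t : exists u, t = torcl u.
Proof. by exists (repr t); rewrite /torcl reprK. Qed.
Lemma extclP t : exists u, t = extcl u.
Proof. by exists (repr t); rewrite /extcl reprK. Qed.

End Torsion.

Section TorMap.
Variables (A B : zmodType) (f : {additive A -> B}).

Definition tormap0 : {malg int[torgen A]} -> Tor B :=
  mlift (fun t : torgen A =>
           let: (m, x, y) := sval t in tau m (f x) (f y)).

Definition tor_map (t : Tor A) : Tor B := tormap0 (repr t).

Definition ext_map (t : extTor A) : extTor B := extcl (tor_map (repr t)).

Fact f_tors m x : x *+ m = 0 -> f x *+ m = 0.
Proof. by move=> xm; rewrite -raddfMn xm raddf0. Qed.

Lemma tormap0U m x y : (0 < m)%N -> x *+ m = 0 -> y *+ m = 0 ->
  tormap0 (tsym m x y) = tau m (f x) (f y).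
Proof.
move=> m0 /eqP xm /eqP ym; rewrite /tsym; case: insubP => [t _ tE|]; last first.
  by rewrite /= m0 xm ym.
by rewrite /tormap0 mliftU; move: tE; rewrite /= => ->.
Qed.

Fact tormap0_zmod : zmod_morphism tormap0. Proof. exact: mlift_zmod. Qed.

Lemma tormap0_ker u : u \in zspan (@torrel A) -> tormap0 u = 0.
Proof.
move=> uS; apply/eqP; move: u uS.
apply: (@zspan_map _ _ tormap0 (@torrel A) (pred1 0) tormap0_zmod).
  split; first by rewrite inE.
  by move=> a b; rewrite !inE => /eqP -> /eqP ->; rewrite subrr.
have D u v : tormap0 (u + v) = tormap0 u + tormap0 v.
  by apply: (raddfD (mlift _)).
move=> _ [m x x' y m0 xm xm' ym|m x y y' m0 xm ym ym'
         |m n x y m0 n0 xm ym|m n x y m0 n0 xm ym]; rewrite inE tormap0_zmod ?D.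
- rewrite !tormap0U ?mulrnDl ?xm ?xm' ?addr0 // raddfD.
  rewrite -(raddfD (@torcl B)) -(raddfB (@torcl B)) -(raddf0 (@torcl B)).
  rewrite torcl_eq subr0; apply: zspan_sub.
  by apply: TorAddl => //; apply: f_tors.
- rewrite !tormap0U ?mulrnDl ?ym ?ym' ?addr0 // raddfD.
  rewrite -(raddfD (@torcl B)) -(raddfB (@torcl B)) -(raddf0 (@torcl B)).
  rewrite torcl_eq subr0; apply: zspan_sub.
  by apply: TorAddr => //; apply: f_tors.
- rewrite !tormap0U ?muln_gt0 ?m0 //; first last.
  + by rewrite mulrnA ym mul0rn.
  + by rewrite -mulrnA mulnC.
  rewrite raddfMn -(raddfB (@torcl B)) -(raddf0 (@torcl B)).
  rewrite torcl_eq subr0; apply: zspan_sub.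
  by apply: TorMull => //; apply: f_tors.
- rewrite !tormap0U ?muln_gt0 ?m0 //; first last.
  + by rewrite mulrnA xm mul0rn.
  + by rewrite -mulrnA mulnC.
  rewrite raddfMn -(raddfB (@torcl B)) -(raddf0 (@torcl B)).
  rewrite torcl_eq subr0; apply: zspan_sub.
  by apply: TorMulr => //; apply: f_tors.
Qed.

Lemma tor_mapE u : tor_map (torcl u) = tormap0 u.
Proof.
apply/eqP; rewrite -subr_eq0 -tormap0_zmod; apply/eqP/tormap0_ker.
by rewrite -torcl_eq /torcl reprK.
Qed.

Lemma tor_map_tau m x y : (0 < m)%N -> x *+ m = 0 -> y *+ m = 0 ->
  tor_map (tau m x y) = tau m (f x) (f y).
Proof. by move=> *; rewrite tor_mapE tormap0U. Qed.

Fact tor_map_zmod : zmod_morphism tor_map.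
Proof.
move=> s t; have [u ->] := torclP s; have [v ->] := torclP t.
by rewrite -raddfB !tor_mapE tormap0_zmod.
Qed.

Lemma ext_mapE t : ext_map (extcl t) = extcl (tor_map t).
Proof.
apply/eqP; rewrite extcl_eq -tor_map_zmod.
have : repr (extcl t) - t \in zspan (@taudiag A).
  by rewrite -extcl_eq /extcl reprK.
move: (_ - t); apply: (zspan_map tor_map_zmod (zspan_closed _)).
move=> _ [m [x [m0 xm ->]]]; apply: zspan_sub.
by exists m, (f x); rewrite tor_map_tau // f_tors.
Qed.

Fact ext_map_zmod : zmod_morphism ext_map.
Proof.
move=> s t; have [u ->] := extclP s; have [v ->] := extclP t.
by rewrite -raddfB !ext_mapE tor_map_zmod raddfB.
Qed.

End TorMap.

Section PairMap.
Variables (F G : groupType) (phi : {multiplicative F -> G}).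

Lemma mult1 : phi 1%g = 1%g.
Proof. by apply: (@mulgI G (phi 1%g)); rewrite -gmulfM !mulg1. Qed.
Lemma multV x : phi x^-1%g = (phi x)^-1%g.
Proof. by apply: (@mulgI G (phi x)); rewrite -gmulfM !mulgV mult1. Qed.

Lemma mult_gen (S : F -> Prop) (H : {pred G}) : group_closed H ->
  (forall s, S s -> phi s \in H) -> forall x, x \in gen S -> phi x \in H.
Proof.
move=> [H1 HF] SH x; apply: (@gen_min F S (fun x => phi x \in H)) => //.
split; first by rewrite unfold_in mult1.
by move=> u v; rewrite !unfold_in gmulfM multV; apply: HF.
Qed.

Lemma mult_lcs (H : {pred F}) (K : {pred G}) n :
  (forall x, x \in H -> phi x \in K) ->
  forall x, x \in lcs H n -> phi x \in lcs K n.
Proof.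
move=> HK; rewrite /lcs; elim: n.-1 => [|m IHm] //=.
apply: mult_gen; first exact: gen_group.
move=> _ [a [b [aH bH ->]]]; apply: gen_sub; exists (phi a), (phi b).
by split; [exact: IHm|exact: HK|rewrite /cmt !gmulfM !multV].
Qed.

Lemma mult_mulsub (H H' : {pred F}) (K K' : {pred G}) :
  (forall x, x \in H -> phi x \in K) -> (forall x, x \in H' -> phi x \in K') ->
  forall x, x \in mulsub H H' -> phi x \in mulsub K K'.
Proof.
move=> HK HK' _ /asboolP[h [h' [hH hH' ->]]]; apply/asboolP.
by exists (phi h), (phi h'); rewrite gmulfM; split; [exact: HK|exact: HK'|].
Qed.

Lemma augid_map (N : {pred F}) (M : {pred G}) :
  (forall x, x \in N -> phi x \in M) ->
  forall u, u \in augid N -> gring_map phi u \in augid M.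
Proof.
move=> NM u /asboolP[uN u0]; apply/asboolP; split=> [g gM|].
  rewrite /gring_map /mlift raddf_sum big1_seq //= => k ku.
  rewrite raddfMz /= mcoeffU; case: eqP => [kg|_]; last by rewrite mul0rz.
  have kN : k \in N.
    by apply: contraLR ku => /uN/eqP; rewrite mcoeff_eq0.
  by rewrite -kg NM in gM.
rewrite -[RHS]u0.
move: u {uN u0}; apply: gring_eq.
- by move=> u v; rewrite gring_map_zmod augB.
- exact: augB.
by move=> x; rewrite gring_mapU !augU.
Qed.

Lemma mulideal_map (I J : {pred gring F}) (I' J' : {pred gring G}) :
  (forall u, u \in I -> gring_map phi u \in I') ->
  (forall u, u \in J -> gring_map phi u \in J') ->
  forall u, u \in mulideal I J -> gring_map phi u \in mulideal I' J'.
Proof.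
move=> II JJ; apply: zspan_map; [exact: gring_map_zmod|exact: zspan_closed|].
move=> _ [u [v [uI vJ ->]]]; rewrite gring_mapM.
by apply: mulideal_in; [exact: II|exact: JJ].
Qed.

Lemma reldim_map (N : {pred F}) (M : {pred G}) n :
  (forall x, x \in N -> phi x \in M) ->
  forall x, x \in reldim N n -> phi x \in reldim M n.
Proof.
move=> NM x /asboolP[u [v [uI vJ xuv]]]; apply/asboolP.
have w : forall u, u \in augid whole -> gring_map phi u \in augid whole.
  exact: augid_map.
exists (gring_map phi u), (gring_map phi v); split.
- by apply: mulideal_map uI => //; apply: augid_map.
- case: n vJ => [|n] //= vJ; elim: n v vJ {xuv} => [|n IHn] v /=; first exact: w.
  exact: mulideal_map.
have gB := gring_map_zmod phi.
have -> : v = u + v - u by rewrite addrAC subrr add0r.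
by rewrite gB -xuv [RHS]addrC subrK gB -!gelt1 !gring_mapU mult1.
Qed.

Variables (R : normalClosed F) (S : normalClosed G).

Definition pair_morphism := forall r, r \in R -> phi r \in S.

Definition relab_map (h : pair_morphism) (x : relab R) : relab S :=
  abcl S (phi (repr (x : gquot _))).

Variable phiRS : pair_morphism.

Lemma relab_mapE a : relab_map phiRS (abcl R a) = abcl S (phi a).
Proof.
apply/esym/abcl_eq; rewrite -multV -gmulfM.
apply: (@mult_mulsub R (lcs whole 2)) => //; first exact: mult_lcs.
exact: repr_coset.
Qed.

Fact relab_map_zmod : zmod_morphism (relab_map phiRS).
Proof.
move=> x y; have [a ->] := abclP x; have [b ->] := abclP y.
have V (K : groupType) (T : normalClosed K) c : - abcl T c = abcl T c^-1%g.
  by apply/eqP; rewrite eq_sym -addr_eq0 -abclM mulVg.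
by rewrite V -abclM !relab_mapE V -abclM gmulfM multV.
Qed.

HB.instance Definition _ :=
  GRing.isZmodMorphism.Build (relab R) (relab S) (relab_map phiRS) relab_map_zmod.

Definition dimsub_map (d : gsub (reldim R 3)) : gsub (reldim S 3) :=
  GSub (reldim_map phiRS (gvalP d)).

Definition dimquo_map (q : dimquo R) : dimquo S :=
  dimcl (dimsub_map (repr (q : gquot _))).

Lemma dimquo_mapE d : dimquo_map (dimcl d) = dimcl (dimsub_map d).
Proof.
apply/esym/sqcl_eq; rewrite /= -multV -gmulfM.
apply: (@mult_mulsub (lcs R 2) (lcs whole 3)); [exact: mult_lcs|exact: mult_lcs|].
pose N : normalClosed (gsub (reldim R 3)) :=
  relsub (mulsub (lcs R 2) (lcs whole 3)).
have: gval (d^-1 * repr (coset N d))%g \in mulsub (lcs R 2) (lcs whole 3).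
  exact: (repr_coset N d).
by rewrite gvalM gvalV.
Qed.

End PairMap.

(* Main.v *)
Require Import Defs.
From HB Require Import structures.
From mathcomp Require Import all_boot ssralg ssrint intdiv matrix.
From mathcomp Require Import boolp monalg.

Set Implicit Arguments.
Unset Strict Implicit.
Unset Printing Implicit Defensive.

Import GRing.Theory.
Local Open Scope ring_scope.

(** Write V = F/F', a free abelian group, and W for the image of R in V, so
    that A = V/W.  Modulo gamma_3(F), commutators are a bilinear alternating
    pairing on V, and the second-order Magnus coefficients of an element w of
    F' record it as an antisymmetric tensor S in V (x) V.  An element of
    D_3(F,R) has its tensor in W (x) V, because the summand re of the defining
    ideal contributes W (x) V and f^3 contributes nothing; elements of
    R' gamma_3(F) have their tensors in the antisymmetric part of W (x) W.  On
    the other side Tor(A,A) is (W (x) V meet V (x) W) / W (x) W, with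
    tau_m(x,y) standing for m a (x) b, and the theorem says that the
    antisymmetrization t - t^T, which corresponds to forming [a^m, b], becomes
    bijective once the classes tau_m(x,x) are killed.

    What makes this work is the Smith normal form.  Finitely many elements of
    V lie in a direct summand with a basis e_1, ..., e_n adapted to W: there
    are integers d_i such that d_i e_i lies in W and divides the i-th component
    of those among the given elements that lie in W (adapted_coords).
    If every column of S lies in W, then d_i divides S_ij for all j, and when S
    is symmetric or antisymmetric so does d_j; hence the symbol
    tau_(S_ij)(e_i, e_j) makes sense for every pair i, j.

    Surjectivity (ext_der_surj): for w in D_3(F,R) the tensor S is
    antisymmetric with columns in W, and w is the image of the sum over i < j of
    tau_(S_ij)(e_i, e_j).  That the columns lie in W is seen through maps
    c : F -> A with c(ab) = c(a) + c(b) + a psi(b), where psi : F -> Z is a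
    homomorphism; they exist because F is free (free_cocycle), and they vanish
    on D_3(F,R) (cocycle_reldim).

    Injectivity (ext_der_inj): if the product of the [a_k^m_k, b_k] equals a
    product of commutators [r_l, s_l] modulo gamma_3(F), then
    S = sum m_k a_k (x) b_k - sum r_l (x) s_l is symmetric.  Expanding in an
    adapted basis, sum tau_(m_k)(x_k, y_k) is the sum over all i, j of
    tau_(S_ij)(e_i, e_j) (etau_coords), the terms r_l (x) s_l contributing zero
    (etauz_tors).  A symmetric S gives zero, since modulo the tau_m(x,x) the
    symbols are alternating (etauz_sym0). *)

(** * Homomorphisms from a group to an abelian group *)

(** A predicate rather than a bundled morphism: the source is written
    multiplicatively and the target additively. *)
Definition zhom (G : groupType) (U : zmodType) (f : G -> U) :=
  forall a b : G, f (a * b)%g = f a + f b.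

Definition zpow (G : groupType) (g : G) (z : int) : G :=
  match z with Posz n => (g ^+ n)%g | Negz n => (g ^- n.+1)%g end.

Section Zhom.
Variables (G : groupType) (U : zmodType) (f : G -> U).
Hypothesis fM : zhom f.

Lemma zhom1 : f 1%g = 0.
Proof. by apply: (@addrI _ (f 1%g)); rewrite -fM mulg1 addr0. Qed.

Lemma zhomV a : f a^-1%g = - f a.
Proof. by apply: (@addrI _ (f a)); rewrite -fM mulgV zhom1 subrr. Qed.

Lemma zhomX a n : f (a ^+ n)%g = f a *+ n.
Proof. by elim: n => [|n IHn]; rewrite ?zhom1 // expgS fM IHn mulrS. Qed.

Lemma zhom_zpow a z : f (zpow a z) = f a *~ z.
Proof. by case: z => n /=; rewrite ?zhomV zhomX. Qed.

Lemma zhom_prod (I : Type) (s : seq I) (h : I -> G) :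
  f (\big[*%g/1%g]_(i <- s) h i) = \sum_(i <- s) f (h i).
Proof. exact: (big_morph f fM zhom1). Qed.

Lemma zhom_cmt a b : f (cmt a b) = 0.
Proof. by rewrite /cmt !fM !zhomV addrAC addrK subrr. Qed.

Lemma zhom_gen (S : G -> Prop) : (forall s, S s -> f s = 0) ->
  forall g, g \in gen S -> f g = 0.
Proof.
move=> S0 g gS; apply/eqP; move: g gS.
apply: (@gen_min _ _ (fun g => f g == 0)).
  split; first by rewrite unfold_in zhom1.
  move=> a b; rewrite !unfold_in fM zhomV => /eqP-> /eqP->.
  by rewrite subrr.
by move=> s /S0 fs; rewrite unfold_in fs.
Qed.

Lemma zhom_der g : g \in lcs whole 2 -> f g = 0.
Proof. by apply: zhom_gen => _ [a [b [_ _ ->]]]; apply: zhom_cmt. Qed.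

End Zhom.

(** Inverses are absorbed, as [a, b]^-1 = [b, a]. *)
Lemma comsub_prod (G : groupType) (H : groupClosed G) (w : G) :
  w \in lcs H 2 -> exists s : seq (gsub H * gsub H),
    w = \big[*%g/1%g]_(p <- s) cmt (gval p.1) (gval p.2).
Proof.
pose P (w : G) := exists s : seq (gsub H * gsub H),
    w = \big[*%g/1%g]_(p <- s) cmt (gval p.1) (gval p.2).
suff: {subset lcs H 2 <= (fun w => `[< P w >])} by move=> PH /PH/asboolP.
apply: gen_min.
  split; first by apply/asboolP; exists [::]; rewrite big_nil.
  move=> _ _ /asboolP[s ->] /asboolP[t ->]; apply/asboolP.
  exists (s ++ rev [seq (p.2, p.1) | p <- t]); rewrite big_cat; congr (_ * _)%g.
  rewrite -[in LHS](revK t) -prodgV -map_rev big_map; apply: eq_bigr => p _ /=.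
  by rewrite /cmt !invgM !invgK !mulgA.
move=> _ [a [b [aH bH ->]]]; apply/asboolP; exists [:: (GSub aH, GSub bH)].
by rewrite big_seq1.
Qed.

(** * Free groups *)

Section Heisenberg.
Variable U : zmodType.

(** Unitriangular 3 x 3 matrices with entries in U, Z and U: the central
    extension of U x Z by U whose cocycle is (a, m), (b, n) |-> n a. *)
Definition heis := (U * int * U)%type.
HB.instance Definition _ := Choice.on heis.

Definition heis_mul (p q : heis) : heis :=
  (p.1.1 + q.1.1, p.1.2 + q.1.2, p.2 + q.2 + p.1.1 *~ q.1.2).
Definition heis_inv (p : heis) : heis :=
  (- p.1.1, - p.1.2, p.1.1 *~ p.1.2 - p.2).

Fact heis_mulA : associative heis_mul.
Proof.
move=> [[a m] x] [[b n] y] [[c k] z]; congr (_, _, _); rewrite /= ?addrA //.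
rewrite mulrzDr mulrzDl [in RHS](addrAC (x + y)) [in RHS](addrC (a *~ k)).
by rewrite [in RHS]addrACA !addrA.
Qed.

Fact heis_mul1 : left_id (0, 0, 0) heis_mul.
Proof.
by move=> [[a m] x]; rewrite /heis_mul /= !add0r mul0rz addr0.
Qed.

Fact heis_mulr1 : right_id (0, 0, 0) heis_mul.
Proof.
by move=> [[a m] x]; rewrite /heis_mul /= !addr0.
Qed.

Fact heis_mulV : left_inverse (0, 0, 0) heis_inv heis_mul.
Proof.
move=> [[a m] x]; rewrite /heis_mul /= !addNr subrK.
by rewrite mulNrz subrr.
Qed.

Fact heis_mulrV : right_inverse (0, 0, 0) heis_inv heis_mul.
Proof.
move=> [[a m] x]; rewrite /heis_mul /= mulrNz !subrr addrCA subrr addr0.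
by rewrite subrr.
Qed.

HB.instance Definition _ :=
  isGroup.Build heis heis_mulA heis_mul1 heis_mulr1 heis_mulV heis_mulrV.

End Heisenberg.

Section Free.
Variables (F : groupType) (X : F -> Prop).
Hypothesis freeX : free_on X.

(** The universal property retracts F onto the subgroup generated by X, and by
    uniqueness this retraction followed by the inclusion is the identity. *)
Lemma free_on_gen g : g \in gen X.
Proof.
pose H := HB.pack_for (groupClosed F) (gen X)
  (isMulClosed.Build F (gen X) (group_closedM (gen_group X)))
  (isMul1Closed.Build F (gen X) (gen_group X).1)
  (isInvClosed.Build F (gen X) (group_closedV (gen_group X))).
have [r rX _] := freeX (fun x => insubd (1%g : gsub H) x).
have [i _ iU] := freeX id.
pose vr (x : F) : F := gval (r x).
have vrM : {morph vr : x y / (x * y)%g} by move=> x y; rewrite /vr gmulfM gvalM.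
pose v := HB.pack_for {multiplicative F -> F} vr
  (monoid.isMultiplicative.Build F F vr vrM).
pose j := HB.pack_for {multiplicative F -> F} (@id F)
  (monoid.isMultiplicative.Build F F id (fun _ _ => erefl)).
have -> : g = gval (r g).
  rewrite -[RHS]/(v g) iU => [|x Xx]; first by rewrite -[LHS]/(j g) iU.
  rewrite /= /vr rX //; apply: (insubdK (1%g : gsub H)).
  exact: gen_sub.
exact: gvalP.
Qed.

Lemma free_zhom_ext (U : zmodType) (f h : F -> U) : zhom f -> zhom h ->
  (forall x, X x -> f x = h x) -> f =1 h.
Proof.
move=> fM hM fh g; apply/eqP; rewrite -subr_eq0; apply/eqP.
apply: (@zhom_gen _ _ (fun g => f g - h g) _ X) (free_on_gen g).
  by move=> a b; rewrite fM hM opprD addrACA.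
by move=> s /fh ->; rewrite subrr.
Qed.

(** The additive group U is embedded in its Heisenberg group, which serves as
    the multiplicative target that the universal property asks for. *)
Lemma free_zhom_exists (U : zmodType) (f : F -> U) :
  exists2 h : F -> U, zhom h & forall x, X x -> h x = f x.
Proof.
have [r rX _] := freeX (fun x => (f x, 0, 0) : heis U).
exists (fun g => (r g).1.1) => [a b|x Xx]; first by rewrite gmulfM.
by rewrite rX.
Qed.

(** A central extension of a free group splits: (f, psi) lifts to the
    Heisenberg group, and c is the last component of the lift.  This is where
    second-order Magnus coefficients come from. *)
Lemma free_cocycle (U : zmodType) (f : F -> U) (psi : F -> int) :
  zhom f -> zhom psi ->
  exists c : F -> U, forall a b, c (a * b)%g = c a + c b + f a *~ psi b.
Proof.
move=> fM psiM; have [r rX _] := freeX (fun x => (f x, psi x, 0) : heis U).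
have r1 : (fun g => (r g).1.1) =1 f.
  by apply: free_zhom_ext => // [a b|x /rX->]; rewrite ?gmulfM.
have r2 : (fun g => (r g).1.2) =1 psi.
  by apply: free_zhom_ext => // [a b|x /rX->]; rewrite ?gmulfM.
exists (fun g => (r g).2) => a b; by rewrite gmulfM -r1 -r2.
Qed.

End Free.

(** * Finite coordinate systems in a free group *)

(** Equality of g with the product of the x_i ^ phi_i(g) in F/F', tested
    against all homomorphisms to abelian groups, which is how it is used. *)
Definition coords (F : groupType) (n : nat) (x : 'I_n -> F)
    (phi : 'I_n -> F -> int) (g : F) : Prop :=
  forall (U : zmodType) (f : F -> U), zhom f ->
    f g = \sum_i f (x i) *~ phi i g.

Section Coordinates.
Variables (F : groupType).
Hypothesis freeF : free_group F.

(** Finitely many elements involve finitely many free generators.  The support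
    of g is enlarged freely (Z in the proof), so that all elements of gs can
    share one list of generators. *)
Lemma free_coords (gs : seq F) :
  exists (n : nat) (x : 'I_n -> F) (phi : 'I_n -> F -> int),
    (forall i, zhom (phi i)) /\ (forall g, g \in gs -> coords x phi g).
Proof.
have [X freeX] := freeF.
have /choice[phi phiP] : forall y : F, exists h : F -> int,
    zhom h /\ forall x, X x -> h x = (x == y)%:R.
  move=> y.
  have [h hM hX] := free_zhom_exists freeX (fun x => (x == y)%:R : int).
  by exists h.
pose supp (g : F) := exists Y : seq F, forall Z : seq F, uniq Z ->
  {subset Y <= Z} -> forall (U : zmodType) (f : F -> U), zhom f ->
  f g = \sum_(y <- Z) f y *~ phi y g.
have suppP g : supp g.
  apply/asboolP; move: g (free_on_gen freeX g).
  apply: (@gen_min _ _ (fun g => `[< supp g >])).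
    split=> [|g h /asboolP[Y Yg] /asboolP[Y' Yh]]; apply/asboolP.
      exists [::] => Z _ _ U f fM; rewrite zhom1 // big1 // => y _.
      by rewrite zhom1 //; case: (phiP y).
    exists (Y ++ Y') => Z uZ sZ U f fM; rewrite fM zhomV //.
    rewrite (Yg Z) // => [|y yY]; last by rewrite sZ // mem_cat yY.
    rewrite (Yh Z) // => [|y yY]; last by rewrite sZ // mem_cat yY orbT.
    rewrite -sumrB; apply: eq_bigr => y _; have [phM _] := phiP y.
    by rewrite phM zhomV // mulrzBr.
  move=> x Xx; apply/asboolP; exists [:: x] => Z uZ sZ U f fM.
  have xZ : x \in Z by apply: sZ; rewrite inE.
  rewrite (bigD1_seq x) //= (phiP x).2 // eqxx big1 ?addr0 // => y yx.
  by rewrite (phiP y).2 // eq_sym (negPf yx) mulr0z.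
have /choice[Y YP] := suppP.
pose Z := undup (flatten [seq Y g | g <- gs]).
exists (size Z), (fun i => nth 1%g Z i), (fun i => phi (nth 1%g Z i)).
split=> [i|g gs_g U f fM]; first by case: (phiP (nth 1%g Z i)).
rewrite (YP g Z) ?undup_uniq // => [|y yY]; last first.
  by rewrite mem_undup; apply/flatten_mapP; exists g.
by rewrite (big_nth 1%g) big_mkord.
Qed.

(** Smith normal form of the matrix M of coordinates of ws: if M = L D Q with L,
    Q invertible, the rows of Q are a new basis e, in which the coordinates of
    the elements of ws are the rows of L D, and d_i e_i is a row of
    L^-1 M, hence a combination of ws. *)
Lemma adapted_coords (A : zmodType) (pi : F -> A) (gs ws : seq F) :
  zhom pi -> (forall w, w \in ws -> pi w = 0) ->
  exists (n : nat) (e : 'I_n -> F) (c : 'I_n -> F -> int) (d : 'I_n -> int),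
  [/\ forall i, zhom (c i), forall g, g \in gs -> coords e c g,
      forall i, pi (e i) *~ d i = 0 &
      forall i w, w \in ws -> (d i %| c i w)%Z].
Proof.
move=> piM piw; have [n [x [phi [phiM phiP]]]] := free_coords (gs ++ ws).
pose M : 'M[int]_(size ws, n) := \matrix_(k, j) phi j (nth 1%g ws k).
have [L uL [Q uQ [d _ defM]]] := int_Smith_normal_form M.
set D := \matrix_(i, j) _ in defM.
pose v g : 'rV[int]_n := \row_j phi j g.
pose e i := \big[*%g/1%g]_j zpow (x j) (Q i j).
pose c i g := (v g *m invmx Q) ord0 i.
(* The columns of D with index at least size ws are zero; there d_i = 0. *)
exists n, e, c, (fun i => if (i < size ws)%N then d`_i else 0).
have fe (U : zmodType) (f : F -> U) i : zhom f ->
    f (e i) = \sum_j f (x j) *~ Q i j.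
  by move=> fM; rewrite zhom_prod //; apply: eq_bigr => j _; rewrite zhom_zpow.
split.
- move=> i a b; have -> : c i (a * b)%g = ((v a + v b) *m invmx Q) ord0 i.
    by congr ((_ *m _) _ _); apply/rowP => j; rewrite !mxE phiM.
  by rewrite mulmxDl mxE.
- move=> g gs_g U f fM; rewrite (phiP g) ?mem_cat ?gs_g //.
  transitivity (\sum_j f (x j) *~ (v g *m invmx Q *m Q) ord0 j).
    by apply: eq_bigr => j _; rewrite mulmxKV // mxE.
  under [RHS]eq_bigr => i _ do rewrite fe // mulrz_suml.
  rewrite exchange_big /=; apply: eq_bigr => j _; rewrite [X in _ *~ X]mxE.
  rewrite mulrz_sumr; apply: eq_bigr => i _.
  by rewrite -mulrzA mulrC.
- move=> i; case: ifP => [iw|_]; last by rewrite mulr0z.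
  pose k := Ordinal iw; rewrite fe // mulrz_suml.
  have DQ j : Q i j * d`_i = \sum_l invmx L k l * M l j.
    transitivity ((invmx L *m M) k j); last by rewrite mxE.
    rewrite defM -mulmxA mulKmx // mxE (bigD1 i) //= mxE eqxx big1 ?addr0.
      by rewrite mulrC.
    move=> l li; rewrite mxE; case: eqP => [il|_]; last by rewrite mul0r.
    by case/eqP: li; apply/val_inj; rewrite /= -il.
  under eq_bigr => j _ do rewrite -mulrzA DQ mulrz_sumr.
  rewrite exchange_big big1 //= => l _.
  have wl : nth 1%g ws l \in ws by rewrite mem_nth.
  transitivity (pi (nth 1%g ws l) *~ invmx L k l); last by rewrite piw ?mul0rz.
  rewrite (phiP (nth 1%g ws l)) ?mem_cat ?wl ?orbT // mulrz_suml.
  by apply: eq_bigr => j _; rewrite mxE -mulrzA mulrC.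
move=> i w /(nthP 1%g)[k kw <-]; pose k' := Ordinal kw.
have -> : c i (nth 1%g ws k) = (L *m D) k' i.
  have <- : M *m invmx Q = L *m D by rewrite defM mulmxK.
  by rewrite /c !mxE; apply: eq_bigr => j _; rewrite !mxE.
rewrite mxE; apply: rpred_sum => l _; rewrite mxE.
case: eqP => [li|_]; last by rewrite mulr0 dvdz0.
by rewrite -li ltn_ord dvdz_mull.
Qed.

End Coordinates.

(** * Second-order coefficients *)

Section Cocycle.
Variables (G : groupType) (U : zmodType).
Variables (f : G -> U) (psi : G -> int) (c : G -> U).
Hypotheses (fM : zhom f) (psiM : zhom psi).
Hypothesis cM : forall a b, c (a * b)%g = c a + c b + f a *~ psi b.

Lemma cocycle1 : c 1%g = 0.
Proof.
apply: (@addrI _ (c 1%g)); rewrite addr0 -{3}[1%g]mulg1 cM.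
by rewrite (zhom1 fM) mul0rz addr0.
Qed.

Lemma cocycle_cmt a b : c (cmt a b) = f a *~ psi b - f b *~ psi a.
Proof.
have: c (cmt a b * (b * a))%g = c (a * b)%g by rewrite /cmt !mulgA !mulgVK.
rewrite (cM _ (b * a)%g) (zhom_cmt fM) mul0rz addr0 (cM a b) (cM b a).
move/(canRL (addrK _)) ->.
by rewrite [c b + c a]addrC opprD addrACA subrr add0r.
Qed.

Lemma cocycleM0 a b : f a = 0 -> c (a * b)%g = c a + c b.
Proof. by move=> fa; rewrite cM fa mul0rz addr0. Qed.

Lemma cocycle_prod (I : Type) (s : seq I) (h : I -> G) :
  (forall i, f (h i) = 0) ->
  c (\big[*%g/1%g]_(i <- s) h i) = \sum_(i <- s) c (h i).
Proof.
move=> fh; elim: s => [|i s IHs]; first by rewrite !big_nil cocycle1.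
by rewrite !big_cons cocycleM0 // IHs.
Qed.

(** In [a, b] with a in F', both f and psi vanish on a, so c does not see the
    commutator: second-order coefficients die on gamma_3. *)
Lemma cocycle_lcs3 g : g \in lcs whole 3 -> c g = 0.
Proof.
pose H g := [&& f g == 0, psi g == 0 & c g == 0].
suff: {subset lcs whole 3 <= H} by move=> sH /sH /and3P[_ _ /eqP].
apply: gen_min; rewrite /H.
  split; first by rewrite unfold_in (zhom1 fM) (zhom1 psiM) cocycle1 !eqxx.
  move=> a b /and3P[/eqP fa /eqP pa /eqP ca] /and3P[/eqP fb /eqP pb /eqP cb].
  have cVb : c b^-1%g = 0.
    by have := cocycle1; rewrite -(mulgV b) cocycleM0 // cb add0r.
  rewrite unfold_in fM psiM (zhomV fM) (zhomV psiM) fa fb pa pb !subrr.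
  by rewrite cocycleM0 // ca cVb addr0 !eqxx.
move=> _ [a [b [a2 _ ->]]]; rewrite unfold_in cocycle_cmt.
rewrite (zhom_cmt fM) (zhom_cmt psiM) (zhom_der fM a2) (zhom_der psiM a2).
by rewrite mul0rz mulr0z subrr !eqxx.
Qed.

(** The product rule for the linear extension of c to the group ring; it shows
    that c is a polynomial map of degree two. *)
Lemma mlift_cocycleM (u v : gring G) :
  mlift c (u * v) = mlift c u *~ augmentation v + mlift c v *~ augmentation u
                    + mlift f u *~ mlift psi v.
Proof.
have mB (h : G -> U) (x y : gring G) : mlift h (x - y) = mlift h x - mlift h y.
  exact: (raddfB (mlift h)).
have mBi (h : G -> int) (x y : gring G) :
    mlift h (x - y) = mlift h x - mlift h y by exact: (raddfB (mlift h)).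
have D3 (a b d a' b' d' : U) :
    a - a' + (b - b') + (d - d') = (a + b + d) - (a' + b' + d').
  by rewrite (addrACA a) -opprD addrACA -opprD.
apply: (gring_eq (f := fun u => mlift c (u * v)) (g := fun u =>
   mlift c u *~ augmentation v + mlift c v *~ augmentation u
   + mlift f u *~ mlift psi v)) u => [u w|u w|g].
- by rewrite mulrBl mB.
- by rewrite !mB augB !mulrzBl mulrzBr D3.
apply: (gring_eq (f := fun v => mlift c (gelt g * v)) (g := fun v =>
   mlift c (gelt g) *~ augmentation v + mlift c v *~ augmentation (gelt g)
   + mlift f (gelt g) *~ mlift psi v)) v => [v w|v w|h].
- by rewrite mulrBr mB.
- by rewrite !mB augB mBi mulrzBl !mulrzBr D3.
by rewrite -geltM !mliftU !augU cM.
Qed.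

End Cocycle.

Section Augmentation.
Variable G : groupType.
Local Notation f := (augid (@whole G)).

Lemma whole_aug0 u : u \in f -> augmentation u = 0.
Proof. by rewrite whole_augid => /eqP. Qed.

Lemma augid_whole (N : {pred G}) : {subset augid N <= f}.
Proof. by move=> u /asboolP[_ u0]; rewrite whole_augid u0. Qed.

Lemma mulideal_kill (U : zmodType) (I J : {pred gring G}) (h : gring G -> U) :
  zmod_morphism h -> (forall u v, u \in I -> v \in J -> h (u * v) = 0) ->
  forall w, w \in mulideal I J -> h w = 0.
Proof.
move=> hB hIJ w wIJ; apply/eqP; move: w wIJ.
apply: (zspan_map (H := pred1 0) hB).
  split; first by rewrite inE.
  by move=> a b; rewrite !inE => /eqP -> /eqP ->; rewrite subrr.
by move=> _ [u [v [uI vJ ->]]]; rewrite inE hIJ.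
Qed.

Lemma aug_mulideal (I : {pred gring G}) u :
  u \in mulideal I f -> augmentation u = 0.
Proof.
apply: mulideal_kill; first exact: augB.
by move=> {}u v _ vf; rewrite augM (whole_aug0 vf) mulr0.
Qed.

(** A homomorphism to an abelian group is a polynomial map of degree one: the
    product rule with the trivial cocycle. *)
Lemma mlift_square (U : zmodType) (h : G -> U) u :
  zhom h -> u \in mulideal f f -> mlift h u = 0.
Proof.
move=> hM; apply: mulideal_kill => [v w|v w vf wf].
  exact: (raddfB (mlift h)).
rewrite (@mlift_cocycleM _ _ (fun=> 0) (fun=> 0)) => [|a b].
  rewrite !whole_aug0 // !mulr0z !add0r /mlift [X in X *~ _]big1 ?mul0rz //.
  by move=> g _; rewrite mul0rz.
by rewrite hM mul0rz addr0.
Qed.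

Lemma reldim_square (N : {pred G}) g :
  g \in reldim N 3 -> gelt g - 1 \in mulideal f f.
Proof.
move=> /asboolP[u [v [uN v3 ->]]].
rewrite -[v]opprK; apply: (zspan_closed _).2.
  move: u uN; apply: zspan_min; first exact: zspan_closed.
  move=> _ [a [b [aN bf ->]]]; apply: mulideal_in => //.
  exact: augid_whole aN.
rewrite -sub0r; apply: (zspan_closed _).2; first exact: (zspan_closed _).1.
move: v v3; apply: zspan_min; first exact: zspan_closed.
move=> _ [a [b [af2 bf ->]]]; apply: mulideal_in => //.
by rewrite whole_augid (aug_mulideal af2).
Qed.

(** The map F -> F/F' extends linearly to the group ring and kills the square
    of the augmentation ideal. *)
Lemma reldim_der (N : {pred G}) g : g \in reldim N 3 -> g \in lcs whole 2.
Proof.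
move=> /reldim_square g2.
have abM : zhom (abcl (lcs whole 2 : normalClosed G)).
  by move=> a b; apply: abclM.
have := mlift_square abM g2.
rewrite (raddfB (mlift _)) /= -gelt1 !mliftU (zhom1 abM) subr0 -(zhom1 abM).
move=> /esym/abcl_eq; rewrite invg1 mul1g => /asboolP[h [k [h2 k2 ->]]].
exact: gpredM.
Qed.

(** The product rule leaves h(u) psi(v) on u v with u, v of augmentation zero:
    this vanishes for u in the augmentation ideal of N since h kills N, and for
    u in the square of the augmentation ideal since h has degree one. *)
Lemma cocycle_reldim (N : {pred G}) (U : zmodType) (h c : G -> U) psi g :
  zhom h -> zhom psi -> (forall a b, c (a * b)%g = c a + c b + h a *~ psi b) ->
  (forall r, r \in N -> h r = 0) -> g \in reldim N 3 -> c g = 0.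
Proof.
move=> hM psiM cM hN /asboolP[u [v [uN v3 gE]]].
have cB : zmod_morphism (mlift c) by exact: raddfB.
have : mlift c (gelt g - 1) = 0; last first.
  by rewrite cB /= -gelt1 !mliftU (cocycle1 hM cM) subr0.
rewrite gE (raddfD (mlift c)) /=.
rewrite (mulideal_kill cB _ uN) => [|a b aN bf]; last first.
  rewrite (mlift_cocycleM cM) !whole_aug0 //; last exact: augid_whole aN.
  rewrite !mulr0z !add0r /mlift [X in X *~ _]big1_seq ?mul0rz //= => k ka.
  rewrite hN ?mul0rz //; apply: contraLR ka => kN.
  by case/asboolP: aN => a0 _; rewrite -mcoeff_eq0 a0.
rewrite add0r; move: v3; apply: mulideal_kill => // a b a2 bf.
rewrite (mlift_cocycleM cM) (whole_aug0 bf) (aug_mulideal a2).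
by rewrite (mlift_square hM) // !mulr0z mul0rz !addr0.
Qed.

End Augmentation.

(** * Commutators in the relative dimension subgroup *)

Section Membership.
Variables (F : groupType) (R : normalClosed F).
Local Notation f := (augid (@whole F)).
Local Notation I := (addsub (mulideal (augid R) f) (expideal f 3)).

Let I_closed : GRing.zmod_closed I.
Proof. by apply: addsub_closed; exact: zspan_closed. Qed.

Let I_add u v : u \in I -> v \in I -> u + v \in I.
Proof. exact: (GRing.zmod_closedD I_closed).2. Qed.

Let inI_re u : u \in mulideal (augid R) f -> u \in I.
Proof.
move=> uI; apply/asboolP; exists u, 0; rewrite addr0; split=> //.
exact: (zspan_closed _).1.
Qed.

Let inI_3 u : u \in expideal f 3 -> u \in I.
Proof.
move=> uI; apply/asboolP; exists 0, u; rewrite add0r; split=> //.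
exact: (zspan_closed _).1.
Qed.

Lemma square_mull u v : u \in f -> v \in mulideal f f -> u * v \in expideal f 3.
Proof.
move=> uf; apply: (zspan_map (f := fun v => u * v)) => [x y||].
- by rewrite mulrBr.
- exact: zspan_closed.
move=> _ [a [b [af bf ->]]]; rewrite mulrA; apply: mulideal_in => //.
exact: mulideal_in.
Qed.

(** If g = r c then (g - 1) v = (r - 1) c v + (c - 1) v, with c - 1 in the
    square of the augmentation ideal. *)
Lemma mulsub_aug g v : g \in mulsub R (lcs whole 2) -> v \in f ->
  (gelt g - 1) * v \in I.
Proof.
move=> /asboolP[r [c [rR c2 ->]]] vf.
have rf : gelt r - 1 \in f by apply: (@augid_sub1 _ whole).
have cf : gelt c - 1 \in f by apply: (@augid_sub1 _ whole).
have -> : (gelt (r * c)%g - 1) * v =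
    (gelt r - 1) * (gelt c * v) + (gelt c - 1) * v.
  rewrite mulrA -mulrDl; congr (_ * _).
  by rewrite geltM mulrBl mul1r addrA subrK.
apply: I_add.
  apply/inI_re/mulideal_in; first exact: augid_sub1.
  by rewrite whole_augid augM (whole_aug0 vf) mulr0.
apply/inI_3/mulideal_in => //; exact: lcs2_sub.
Qed.

(** Modulo its square, the augmentation ideal turns products into sums. *)
Lemma gelt_expg (a : F) m :
  gelt (a ^+ m)%g - 1 - (gelt a - 1) *+ m \in mulideal f f.
Proof.
elim: m => [|m IHm]; first by rewrite subrr subr0; exact: (zspan_closed _).1.
rewrite expgS geltM mulrS.
have -> : gelt a * gelt (a ^+ m)%g - 1 - (gelt a - 1 + (gelt a - 1) *+ m) =
    (gelt (a ^+ m)%g - 1 - (gelt a - 1) *+ m)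
    - (gelt a - 1) * - (gelt (a ^+ m)%g - 1).
  rewrite mulrN opprK [in RHS]mulrBl mul1r [RHS]addrC addrA subrK mulrBr mulr1.
  by rewrite opprD addrA opprB addrA subrK.
apply: (zspan_closed _).2 => //; apply: mulideal_in.
  exact: (@augid_sub1 _ whole).
rewrite -sub0r; apply: (augid_closed _).2; first exact: (augid_closed _).1.
exact: (@augid_sub1 _ whole).
Qed.

(** In (a^m - 1)(b - 1) - (b - 1)(a^m - 1), the first product is handled by
    a^m in R F'.  In the second, the exponent m is moved across modulo the cube
    of the augmentation ideal, giving (b^m - 1)(a - 1) with b^m in R F'. *)
Lemma cmt_reldim (m : nat) (a b : F) :
  abcl R a *+ m = 0 -> abcl R b *+ m = 0 -> cmt (a ^+ m)%g b \in reldim R 3.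
Proof.
have abM : zhom (abcl R) by move=> x y; apply: abclM.
have inRF x : abcl R x *+ m = 0 -> (x ^+ m)%g \in mulsub R (lcs whole 2).
  rewrite -(zhomX abM) -(zhom1 abM) => /esym/abcl_eq.
  by rewrite invg1 mul1g.
have fE x : gelt x - 1 \in f by apply: (@augid_sub1 _ whole).
move=> /inRF aR /inRF bR; rewrite unfold_in gelt_cmt.
apply: rideal_add; [exact/rideal_mul/rideal_whole|exact: rideal_exp|].
apply: I_closed.2; first exact: mulsub_aug.
pose w := gelt (a ^+ m)%g - 1 - (gelt a - 1) *+ m.
have -> : gelt (a ^+ m)%g - 1 = w + (gelt a - 1) *+ m by rewrite subrK.
rewrite mulrDr mulrnAr -mulrnAl; apply: I_add.
  by apply/inI_3/square_mull => //; apply: gelt_expg.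
pose z := gelt (b ^+ m)%g - 1 - (gelt b - 1) *+ m.
have -> : (gelt b - 1) *+ m = (gelt (b ^+ m)%g - 1) - z by rewrite subKr.
rewrite mulrBl; apply: I_closed.2; first exact: mulsub_aug.
by apply/inI_3/mulideal_in => //; apply: gelt_expg.
Qed.

End Membership.

(** * The commutator pairing *)

Section Pairing.
Variables (F : groupType) (R : normalClosed F).
Local Notation der := (lcs (@whole F) 2 : groupClosed F).
Local Notation N := (mulsub (lcs R 2) (lcs whole 3) : normalClosed F).

(** F'/R' gamma_3(F) in additive notation.  It reuses relab for the group F',
    whose own derived subgroup already lies in gamma_3(F). *)
Definition derquo := relab (relsub N : normalClosed (gsub der)).
HB.instance Definition _ := GRing.Zmodule.on derquo.

(** The class in F'/R' gamma_3(F), with value 0 off F'. *)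
Definition kappa (g : F) : derquo := abcl _ (insubd (1%g : gsub der) g).
Definition beta (a b : F) : derquo := kappa (cmt a b).

Lemma cmt_der a b : cmt a b \in der.
Proof. by apply: gen_sub; exists a, b. Qed.

Lemma lcs3_N g : g \in lcs whole 3 -> g \in N.
Proof. by move=> g3; apply/asboolP; exists 1%g, g; rewrite gpred1 mul1g. Qed.

Lemma derR_N g : g \in lcs R 2 -> g \in N.
Proof. by move=> g2; apply/asboolP; exists g, 1%g; rewrite gpred1 mulg1. Qed.

Lemma insub_derK g : g \in der -> gval (insubd (1%g : gsub der) g) = g.
Proof. exact: (insubdK (1%g : gsub der)). Qed.

Lemma kappaM g h : g \in der -> h \in der ->
  kappa (g * h)%g = kappa g + kappa h.
Proof.
move=> gD hD; rewrite /kappa -abclM; congr (abcl _ _); apply/val_inj.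
rewrite -[LHS]/(gval _) -[RHS]/(gval _) gvalM !insub_derK //.
exact: gpredM.
Qed.

Lemma kappa1 : kappa 1%g = 0.
Proof.
by apply: (@addrI _ (kappa 1%g)); rewrite -kappaM ?gpred1 // mulg1 addr0.
Qed.

Lemma kappaV g : g \in der -> kappa g^-1%g = - kappa g.
Proof.
move=> gD; apply: (@addrI _ (kappa g)).
by rewrite -kappaM ?gpredV // mulgV kappa1 subrr.
Qed.

Lemma kappa_prod (I : Type) (s : seq I) (h : I -> F) :
  (forall i, h i \in der) ->
  kappa (\big[*%g/1%g]_(i <- s) h i) = \sum_(i <- s) kappa (h i).
Proof.
move=> hD; elim: s => [|i s IHs]; first by rewrite !big_nil kappa1.
by rewrite !big_cons kappaM ?IHs // gpred_prod.
Qed.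

Lemma kappa_eq0 g : g \in der -> kappa g = 0 <-> g \in N.
Proof.
move=> gD; have gE := insub_derK gD.
rewrite -kappa1 /kappa.
have -> : insubd (1%g : gsub der) 1%g = 1%g.
  by apply/val_inj; rewrite -[LHS]/(gval _) insub_derK ?gpred1 //.
split=> [/esym/abcl_eq|gN]; last first.
  apply/esym/abcl_eq; rewrite invg1 mul1g; apply/asboolP.
  exists (insubd (1%g : gsub der) g), 1%g; rewrite mulg1 relsubE gE.
  by split=> //; apply: gpred1.
rewrite invg1 mul1g => /asboolP[h [k [hN kD gk]]].
rewrite -gE gk gvalM; apply: gpredM; first by rewrite -relsubE.
apply: lcs3_N; move: k kD {gk}.
apply: (@gen_min _ _ (fun k => gval k \in lcs whole 3)).
  split; first by rewrite unfold_in gval1 gpred1.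
  by move=> a b aH bH; rewrite unfold_in gvalM gvalV; apply: gpredF.
move=> _ [a [b [_ _ ->]]]; rewrite unfold_in /cmt !gvalM !gvalV.
by apply: gen_sub; exists (gval a), (gval b); split; rewrite // gvalP.
Qed.

(** g^h = g [g^-1, h^-1], and the commutator is in gamma_3(F). *)
Lemma kappaJ g h : g \in der -> kappa (g ^ h)%g = kappa g.
Proof.
have gVD : g \in der -> g^-1%g \in der by rewrite gpredV.
move=> gD; have cD : cmt g^-1 h^-1 \in lcs (@whole F) 3.
  by apply: gen_sub; exists g^-1%g, h^-1%g; split=> //; exact: gVD.
have -> : (g ^ h = g * cmt g^-1 h^-1)%g.
  by rewrite /cmt !invgK conjgE !mulgA mulgV mul1g.
have cD2 : cmt g^-1 h^-1 \in der by apply: cmt_der.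
by rewrite kappaM // (kappa_eq0 cD2).2 ?addr0 //; apply: lcs3_N.
Qed.

(** [a a', b] = [a', b]^(a^-1) [a, b], and conjugation acts trivially. *)
Lemma betaMl a a' b : beta (a * a')%g b = beta a b + beta a' b.
Proof.
rewrite /beta; have -> : (cmt (a * a') b = (cmt a' b) ^ a^-1 * cmt a b)%g.
  by rewrite /cmt conjgE !invgK !invgM !mulgA !mulgVK.
by rewrite kappaM ?gpredJn ?cmt_der // kappaJ ?cmt_der // addrC.
Qed.

Lemma betaC a b : beta b a = - beta a b.
Proof.
rewrite /beta -kappaV ?cmt_der //; congr kappa.
by rewrite /cmt !invgM !invgK !mulgA.
Qed.

Lemma betaMr a b b' : beta a (b * b')%g = beta a b + beta a b'.
Proof. by rewrite !(betaC _ a) betaMl opprD. Qed.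

Lemma zhom_betal b : zhom (beta^~ b). Proof. by move=> a a'; apply: betaMl. Qed.
Lemma zhom_betar a : zhom (beta a). Proof. by move=> b b'; apply: betaMr. Qed.

Lemma beta_diag a : beta a a = 0.
Proof. by rewrite /beta /cmt mulgK mulgV kappa1. Qed.

Lemma zhom_abcl : zhom (abcl R). Proof. by move=> a b; apply: abclM. Qed.

Lemma abcl_eq0 a : abcl R a = 0 <-> a \in mulsub R (lcs whole 2).
Proof.
rewrite -(zhom1 zhom_abcl); split=> [/esym/abcl_eq|aR].
  by rewrite invg1 mul1g.
by apply/esym/abcl_eq; rewrite invg1 mul1g.
Qed.

Lemma abcl_R r : r \in R -> abcl R r = 0.
Proof.
by move=> rR; apply/abcl_eq0/asboolP; exists r, 1%g; rewrite gpred1 mulg1.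
Qed.

(** By bilinearity a and b may be replaced by elements of R. *)
Lemma beta_abcl0 a b : abcl R a = 0 -> abcl R b = 0 -> beta a b = 0.
Proof.
move=> /abcl_eq0/asboolP[r [c [rR c2 ->]]] /abcl_eq0/asboolP[s [d [sR d2 ->]]].
rewrite betaMl (zhom_der (zhom_betal _) c2) addr0.
rewrite betaMr (zhom_der (zhom_betar _) d2) addr0.
apply/kappa_eq0; first exact: cmt_der.
by apply/derR_N/gen_sub; exists r, s.
Qed.

(** Changing a by r in R F' changes the value by m [r, b] = [r, b^m], which is
    zero as r and b^m both lie in R F'. *)
Lemma beta_tors m a a' b b' : abcl R a *+ m = 0 -> abcl R b *+ m = 0 ->
  abcl R a = abcl R a' -> abcl R b = abcl R b' ->
  beta a b *+ m = beta a' b' *+ m.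
Proof.
move=> am bm aa' bb'.
have D x x' : abcl R x = abcl R x' -> abcl R (x^-1 * x')%g = 0.
  by move=> xx; rewrite zhom_abcl (zhomV zhom_abcl) xx addNr.
have step x x' y : abcl R x = abcl R x' -> abcl R y *+ m = 0 ->
    beta x' y *+ m = beta x y *+ m.
  move=> /D xx ym.
  have -> : x' = (x * (x^-1 * x'))%g by rewrite mulgA mulgV mul1g.
  rewrite betaMl mulrnDl -[X in _ + X](zhomX (zhom_betar _)).
  rewrite (beta_abcl0 xx) ?addr0 //.
  by rewrite (zhomX zhom_abcl).
rewrite (step a a' b') //; last by rewrite -bb'.
by rewrite !(betaC _ a) !mulNrn (step b b' a).
Qed.

End Pairing.

(** * Calculus in the exterior torsion square *)

Lemma sum_sym_pairs (U : zmodType) (n : nat) (t : 'I_n -> 'I_n -> U) :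
  \sum_i \sum_j t i j =
  \sum_i t i i + \sum_(i : 'I_n) \sum_(j : 'I_n | (i < j)%N) (t i j + t j i).
Proof.
under [X in _ + X]eq_bigr do rewrite big_split /=.
rewrite big_split /= [X in _ = _ + (_ + X)](exchange_big_dep predT) //=.
rewrite addrCA -!big_split /=; apply: eq_bigr => i _.
rewrite (bigID (fun j : 'I_n => (i < j)%N)) /=; congr (_ + _).
rewrite (bigD1 i) ?ltnn //=; congr (_ + _); apply: eq_bigl => j.
by rewrite -leqNgt [RHS]ltn_neqAle andbC.
Qed.

Section ExteriorTorsion.
Variable A : zmodType.
Implicit Types (x y : A) (m n : nat) (z : int).

Definition etau m x y : extTor A := extcl (tau m x y).

Lemma torrel_eq (u v : {malg int[torgen A]}) : 
  torrel (u - v) -> torcl u = torcl v.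
Proof. by move=> uv; apply/eqP; rewrite torcl_eq; apply: zspan_sub. Qed.

Lemma etauDl m x x' y : (0 < m)%N -> x *+ m = 0 -> x' *+ m = 0 -> y *+ m = 0 ->
  etau m (x + x') y = etau m x y + etau m x' y.
Proof.
move=> m0 xm xm' ym; rewrite /etau /tau -!raddfD /=; congr (extcl _).
by apply: torrel_eq; apply: TorAddl.
Qed.

Lemma etauDr m x y y' : (0 < m)%N -> x *+ m = 0 -> y *+ m = 0 -> y' *+ m = 0 ->
  etau m x (y + y') = etau m x y + etau m x y'.
Proof.
move=> m0 xm ym ym'; rewrite /etau /tau -!raddfD /=; congr (extcl _).
by apply: torrel_eq; apply: TorAddr.
Qed.

Lemma etauMl m n x y : (0 < m)%N -> (0 < n)%N ->
  x *+ (m * n) = 0 -> y *+ m = 0 ->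
  etau (m * n) x y = etau m (x *+ n) y.
Proof.
by move=> *; congr (extcl _); apply: torrel_eq; apply: TorMull.
Qed.

Lemma etauMr m n x y : (0 < m)%N -> (0 < n)%N ->
  x *+ m = 0 -> y *+ (m * n) = 0 ->
  etau (m * n) x y = etau m x (y *+ n).
Proof.
by move=> *; congr (extcl _); apply: torrel_eq; apply: TorMulr.
Qed.

Lemma etau_diag m x : (0 < m)%N -> x *+ m = 0 -> etau m x x = 0.
Proof.
move=> m0 xm; rewrite /etau -(raddf0 (@extcl A)); apply/eqP.
by rewrite extcl_eq subr0; apply: zspan_sub; exists m, x.
Qed.

Lemma etauC m x y : (0 < m)%N -> x *+ m = 0 -> y *+ m = 0 ->
  etau m y x = - etau m x y.
Proof.
move=> m0 xm ym; apply/eqP; rewrite -addr_eq0 addrC; apply/eqP.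
have := @etau_diag m (x + y) m0; rewrite mulrnDl xm ym addr0 => /(_ erefl).
rewrite etauDl ?etauDr ?mulrnDl ?xm ?ym ?addr0 //.
by rewrite !etau_diag // add0r addr0.
Qed.

Lemma etau0l m y : (0 < m)%N -> y *+ m = 0 -> etau m 0 y = 0.
Proof.
move=> m0 ym; apply: (@addrI _ (etau m 0 y)).
by rewrite -etauDl ?mul0rn // !addr0.
Qed.

Lemma etau0r m x : (0 < m)%N -> x *+ m = 0 -> etau m x 0 = 0.
Proof. by move=> m0 xm; rewrite etauC ?mul0rn // etau0l ?oppr0. Qed.

Lemma tors_mulz m x z : x *+ m = 0 -> (x *~ z) *+ m = 0.
Proof. by move=> xm; rewrite pmulrn mulrzAC -pmulrn xm mul0rz. Qed.

Lemma etauMzl m x y z : (0 < m)%N -> x *+ m = 0 -> y *+ m = 0 ->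
  etau m (x *~ z) y = etau m x y *~ z.
Proof.
move=> m0 xm ym.
have En n : etau m (x *+ n) y = etau m x y *+ n.
  elim: n => [|n IHn]; first by rewrite etau0l.
  by rewrite !mulrS etauDl ?IHn // mulrnAC xm mul0rn.
case: z => n; first exact: En.
apply/eqP; rewrite NegzE !mulrNz -addr_eq0; apply/eqP.
rewrite -!pmulrn -En -etauDl ?addNr ?etau0l ?mulNrn //;
  by rewrite mulrnAC xm mul0rn ?oppr0.
Qed.

Lemma etauMzr m x y z : (0 < m)%N -> x *+ m = 0 -> y *+ m = 0 ->
  etau m x (y *~ z) = etau m x y *~ z.
Proof.
move=> m0 xm ym; rewrite etauC ?tors_mulz // etauMzl // (etauC _ xm ym) //.
by rewrite mulNrz opprK.
Qed.

Lemma etau_suml (I : Type) (s : seq I) (X : I -> A) m y : (0 < m)%N ->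
  (forall i, X i *+ m = 0) -> y *+ m = 0 ->
  etau m (\sum_(i <- s) X i) y = \sum_(i <- s) etau m (X i) y.
Proof.
move=> m0 Xm ym; elim: s => [|i s IHs]; first by rewrite !big_nil etau0l.
rewrite !big_cons etauDl ?IHs // -sumrMnl big1 // => j _; exact: Xm.
Qed.

Lemma etau_sumr (I : Type) (s : seq I) (Y : I -> A) m x : (0 < m)%N ->
  x *+ m = 0 -> (forall i, Y i *+ m = 0) ->
  etau m x (\sum_(i <- s) Y i) = \sum_(i <- s) etau m x (Y i).
Proof.
move=> m0 xm Ym; elim: s => [|i s IHs]; first by rewrite !big_nil etau0r.
rewrite !big_cons etauDr ?IHs // -sumrMnl big1 // => j _; exact: Ym.
Qed.

(** The symbol tau_z for a possibly negative z, normalized so as to be additive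
    in z on the group of integers killing both x and y (etauzD). *)
Definition etauz z x y : extTor A :=
  if z == 0 then 0 else etau `|z| x y *~ sgz z.

(** The relation tau_(lk)(x,y) = tau_l(kx,y) = k tau_l(x,y). *)
Lemma etauz_mul (l : nat) (k : int) x y :
  (0 < l)%N -> x *+ l = 0 -> y *+ l = 0 ->
  etauz (l%:Z * k) x y = etau l x y *~ k.
Proof.
move=> l0 xl yl; rewrite /etauz mulf_eq0.
have [->|k0] := eqVneq k 0; first by rewrite orbT mulr0z.
rewrite orbF eqz_nat eqn0Ngt l0 /= abszM absz_nat sgzM.
rewrite gtr0_sgz ?mul1r ?ltz_nat //.
rewrite etauMl ?absz_gt0 ?mulrnA ?xl ?mul0rn // pmulrn etauMzl //.
by rewrite -mulrzA mulrC -intEsg.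
Qed.

Lemma tors_abs z x : x *~ z = 0 -> x *+ `|z| = 0.
Proof.
case: z => n //; rewrite NegzE mulrNz => /eqP; rewrite oppr_eq0 => /eqP.
by rewrite abszN.
Qed.

(** The gcd l of z and z' also kills x and y, so both symbols are multiples of
    tau_l(x,y). *)
Lemma etauzD z z' x y :
  x *~ z = 0 -> y *~ z = 0 -> x *~ z' = 0 -> y *~ z' = 0 ->
  etauz (z + z') x y = etauz z x y + etauz z' x y.
Proof.
move=> xz yz xz' yz'.
have [k zk] := dvdzP (dvdz_gcdl z z'); have [k' zk'] := dvdzP (dvdz_gcdr z z').
have [u [v uv]] := Bezoutz z z'.
have kill (t : A) : t *~ z = 0 -> t *~ z' = 0 -> t *+ gcdn `|z| `|z'| = 0.
  move=> tz tz'; rewrite pmulrn -[Posz _]/(gcdz z z') -uv /= mulrzDr.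
  by rewrite ![_ * z]mulrC ![_ * z']mulrC !mulrzA tz tz' !mul0rz addr0.
have g0 := gcdn_gt0 `|z| `|z'|.
have [l0|] := boolP (0 < gcdn `|z| `|z'|)%N; last first.
  rewrite g0 !absz_gt0 negb_or !negbK => /andP[/eqP -> /eqP ->].
  by rewrite /etauz addr0 eqxx addr0.
move: l0 kill zk zk'; rewrite /gcdz.
move: (gcdn _ _) => l l0 kill zk zk' {uv g0}.
rewrite zk zk' -mulrDl ![_ * l%:Z]mulrC !etauz_mul ?kill //.
by rewrite mulrzDr.
Qed.

Lemma etauz0 x y : etauz 0 x y = 0. Proof. by rewrite /etauz eqxx. Qed.

Lemma etauzN z x y : etauz (- z) x y = - etauz z x y.
Proof.
rewrite /etauz oppr_eq0; case: eqP => _; first by rewrite oppr0.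
by rewrite abszN sgzN mulrNz.
Qed.

Lemma etauz_sum (I : eqType) (s : seq I) (Z : I -> int) x y :
  (forall i, i \in s -> x *~ Z i = 0) -> (forall i, i \in s -> y *~ Z i = 0) ->
  etauz (\sum_(i <- s) Z i) x y = \sum_(i <- s) etauz (Z i) x y.
Proof.
elim: s => [|i s IHs] xZ yZ; first by rewrite !big_nil etauz0.
have sZ j : j \in s -> j \in i :: s by rewrite inE orbC => ->.
have tail0 (t : A) : (forall j, j \in i :: s -> t *~ Z j = 0) ->
    t *~ (\sum_(j <- s) Z j) = 0.
  by move=> tZ; rewrite mulrz_sumr big1_seq // => j /sZ/tZ.
rewrite !big_cons etauzD ?xZ ?yZ ?mem_head ?tail0 // IHs // => j /sZ.
  exact: xZ.
exact: yZ.
Qed.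

Lemma etauzC z x y : x *~ z = 0 -> y *~ z = 0 -> etauz z y x = - etauz z x y.
Proof.
rewrite /etauz; case: eqP => [|/eqP z0 /tors_abs xz /tors_abs yz].
  by rewrite oppr0.
by rewrite etauC ?absz_gt0 // mulNrz.
Qed.

Lemma etauz_diag z x : x *~ z = 0 -> etauz z x x = 0.
Proof.
rewrite /etauz; case: eqP => // /eqP z0 /tors_abs xz.
by rewrite etau_diag ?absz_gt0 // mul0rz.
Qed.

(** tau_(zw)(x,y) = tau_z(x,wy) = 0.  This is why W (x) W contributes nothing
    to Tor(A,A). *)
Lemma etauz_tors z w x y : x *~ z = 0 -> y *~ w = 0 -> etauz (z * w) x y = 0.
Proof.
rewrite /etauz mulf_eq0; case: eqP => // /eqP z0; case: eqP => //= /eqP w0.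
move=> /tors_abs xz /tors_abs yw.
rewrite abszM etauMr ?absz_gt0 ?yw ?etau0r ?absz_gt0 ?mul0rz //.
by rewrite mulnC mulrnA yw mul0rn.
Qed.

(** tau_m(px,qy) = tau_(mp)(x,qy) = tau_(mpq)(x,y), up to signs: the symbol
    depends on m p q only. *)
Lemma etau_mulz m (p q : int) x y : (0 < m)%N ->
  x *~ (m%:Z * p) = 0 -> y *~ (m%:Z * q) = 0 ->
  etau m (x *~ p) (y *~ q) = etauz (m%:Z * p * q) x y.
Proof.
move=> m0 xp yq.
have Xm : (x *~ p) *+ m = 0 by rewrite pmulrn -mulrzA mulrC.
have Ym : (y *~ q) *+ m = 0 by rewrite pmulrn -mulrzA mulrC.
rewrite /etauz !mulf_eq0 eqz_nat eqn0Ngt m0 /=.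
have [p0|p0] := eqVneq p 0; first by rewrite p0 mulr0z etau0l.
have [q0|q0] := eqVneq q 0; first by rewrite q0 mulr0z etau0r.
have /tors_abs := xp; have /tors_abs := yq; rewrite !abszM !absz_nat => yq' xp'.
rewrite [in LHS](intEsg p) [in LHS](intEsg q) ![sgz _ * _]mulrC.
rewrite !mulrzA -!pmulrn.
have xm : x *+ `|p| *+ m = 0 by rewrite -mulrnA mulnC.
have ym : y *+ `|q| *+ m = 0 by rewrite -mulrnA mulnC.
rewrite etauMzl ?etauMzr ?tors_mulz //.
rewrite -etauMl ?absz_gt0 // -etauMr ?absz_gt0 //.
- by rewrite !sgzM (@gtr0_sgz _ m%:Z) // mul1r -mulrzA mulrC.
- by rewrite muln_gt0 m0 absz_gt0.
by rewrite mulnAC mulrnA yq' mul0rn.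
Qed.

(** The inverse of Tor(A,A) -> V (x) V / W (x) W in coordinates: the symbol is
    determined by the entries m p_i q_j of the tensor m x (x) y. *)
Lemma etau_coords (n m : nat) (E : 'I_n -> A) (p q : 'I_n -> int) : (0 < m)%N ->
  (forall i, E i *~ (m%:Z * p i) = 0) -> (forall j, E j *~ (m%:Z * q j) = 0) ->
  etau m (\sum_i E i *~ p i) (\sum_j E j *~ q j) =
  \sum_i \sum_j etauz (m%:Z * p i * q j) (E i) (E j).
Proof.
move=> m0 Ep Eq.
have km (r : 'I_n -> int) i : E i *~ (m%:Z * r i) = 0 -> (E i *~ r i) *+ m = 0.
  by rewrite pmulrn -mulrzA mulrC.
have sm (r : 'I_n -> int) : (forall i, E i *~ (m%:Z * r i) = 0) ->
    (\sum_i E i *~ r i) *+ m = 0.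
  by move=> Er; rewrite -sumrMnl big1 // => i _; apply: km.
rewrite etau_suml ?sm // => [|i]; last exact: km.
apply: eq_bigr => i _; rewrite etau_sumr ?km // => [|j]; last exact: km.
by apply: eq_bigr => j _; apply: etau_mulz.
Qed.

(** The diagonal terms vanish and the terms at (i,j) and (j,i) cancel. *)
Lemma etauz_sym0 (n : nat) (E : 'I_n -> A) (S : 'I_n -> 'I_n -> int) :
  (forall i j, S i j = S j i) -> (forall i j, E i *~ S i j = 0) ->
  \sum_i \sum_j etauz (S i j) (E i) (E j) = 0.
Proof.
move=> SC ES.
rewrite sum_sym_pairs big1 ?add0r => [|i _]; last exact: etauz_diag.
rewrite big1 // => i _; rewrite big1 // => j _.
by rewrite (SC j i) (@etauzC _ (E i)) ?subrr // SC.
Qed.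

(** Closure under opposites is automatic: - tau_m(x,y) = tau_m(-x,y). *)
Lemma extTor_ind (P : extTor A -> Prop) : P 0 ->
  (forall u v, P u -> P v -> P (u + v)) ->
  (forall m x y, (0 < m)%N -> x *+ m = 0 -> y *+ m = 0 -> P (etau m x y)) ->
  forall u, P u.
Proof.
move=> P0 PD Pe u; have [t ->] := extclP u; have [v ->] := torclP t.
rewrite [v]malg_sumE !raddf_sum /=; elim/big_ind: _ => // k _.
rewrite !raddfMz /=; case: k => [[[m x] y] kP].
have /and3P[m0 /eqP xm /eqP ym] := kP.
have -> : extcl (torcl << (exist _ (m, x, y) kP : torgen A) >>) = etau m x y.
  congr (extcl (torcl _)); rewrite /tsym; case: insubP => [t' _ tE|].
    by congr << _ >>; apply: val_inj.
  by rewrite [X in ~~ X]kP.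
rewrite -etauMzl //; apply: Pe => //; exact: tors_mulz.
Qed.

End ExteriorTorsion.

(** * The comparison map *)

Section Comparison.
Variables (F : groupType) (R : normalClosed F).
Local Notation A := (relab R).
Local Notation Q := (derquo R).
Local Notation abM := (zhom_abcl R).

Definition ab_lift (x : A) : F := repr (x : gquot (mulsub R (lcs whole 2))).

Lemma ab_liftK x : abcl R (ab_lift x) = x.
Proof. by rewrite /abcl /coset reprK. Qed.

Definition malg_der : {malg int[torgen A]} -> Q :=
  mlift (fun t => let: (m, x, y) := sval t in
                  beta R (ab_lift x) (ab_lift y) *+ m).

Fact malg_der_zmod : zmod_morphism malg_der. Proof. exact: mlift_zmod. Qed.
HB.instance Definition _ :=
  GRing.isZmodMorphism.Build _ Q malg_der malg_der_zmod.

Lemma malg_derE m a b : (0 < m)%N -> abcl R a *+ m = 0 -> abcl R b *+ m = 0 ->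
  malg_der (tsym m (abcl R a) (abcl R b)) = beta R a b *+ m.
Proof.
move=> m0 am bm; rewrite /tsym; case: insubP => [t _ tE|]; last first.
  by rewrite /= m0 am bm !eqxx.
rewrite /malg_der mliftU; move: tE => /= ->.
by apply: beta_tors; rewrite ?ab_liftK.
Qed.

Lemma malg_der_torrel v : v \in zspan (@torrel A) -> malg_der v = 0.
Proof.
move=> vS; apply/eqP; move: v vS.
apply: (@zspan_map _ _ malg_der (@torrel A) (pred1 0) malg_der_zmod).
  split; first by rewrite inE.
  by move=> a b; rewrite !inE => /eqP -> /eqP ->; rewrite subrr.
have bl := zhom_betal R; have br := zhom_betar R.
move=> _ [m x x' y m0|m x y y' m0|m n x y m0 n0|m n x y m0 n0]; rewrite inE.
- rewrite -(ab_liftK x) -(ab_liftK x') -(ab_liftK y) => xm xm' ym.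
  rewrite raddfB raddfD /= -abclM !malg_derE //; last first.
    by rewrite abM mulrnDl xm xm' addr0.
  by rewrite betaMl mulrnDl subrr.
- rewrite -(ab_liftK x) -(ab_liftK y) -(ab_liftK y') => xm ym ym'.
  rewrite raddfB raddfD /= -abclM !malg_derE //; last first.
    by rewrite abM mulrnDl ym ym' addr0.
  by rewrite betaMr mulrnDl subrr.
- rewrite -(ab_liftK x) -(ab_liftK y) => xm ym.
  rewrite raddfB /= -(zhomX abM) !malg_derE ?muln_gt0 ?m0 //.
  + by rewrite (zhomX (bl _)) -mulrnA mulnC subrr.
  + by rewrite (zhomX abM) -mulrnA mulnC.
  + by rewrite mulrnA ym mul0rn.
- rewrite -(ab_liftK x) -(ab_liftK y) => xm ym.
  rewrite raddfB /= -(zhomX abM) !malg_derE ?muln_gt0 ?m0 //.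
  + by rewrite (zhomX (br _)) -mulrnA mulnC subrr.
  + by rewrite (zhomX abM) -mulrnA mulnC.
  + by rewrite mulrnA xm mul0rn.
Qed.

Definition tor_der (t : Tor A) : Q := malg_der (repr t).
(** The comparison map with values in F'/R' gamma_3(F); it sends tau_m(x,y) to
    the class of [a,b]^m, that is of [a^m,b]. *)
Definition ext_der (u : extTor A) : Q := tor_der (repr u).

Lemma tor_derE v : tor_der (torcl v) = malg_der v.
Proof.
apply/eqP; rewrite -subr_eq0 -malg_der_zmod; apply/eqP/malg_der_torrel.
by rewrite -torcl_eq /torcl reprK.
Qed.

Fact tor_der_zmod : zmod_morphism tor_der.
Proof.
move=> s t; have [u ->] := torclP s; have [v ->] := torclP t.
by rewrite -raddfB !tor_derE malg_der_zmod.
Qed.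

Lemma ext_derE t : ext_der (extcl t) = tor_der t.
Proof.
apply/eqP; rewrite -subr_eq0 -tor_der_zmod.
have : repr (extcl t) - t \in zspan (@taudiag A).
  by rewrite -extcl_eq /extcl reprK.
move: (_ - t).
apply: (@zspan_map _ _ tor_der (@taudiag A) (pred1 0) tor_der_zmod).
  split; first by rewrite inE.
  by move=> a b; rewrite !inE => /eqP -> /eqP ->; rewrite subrr.
move=> _ [m [x [m0 xm ->]]]; rewrite inE tor_derE -(ab_liftK x).
by rewrite malg_derE ?ab_liftK // beta_diag mul0rn.
Qed.

Fact ext_der_zmod : zmod_morphism ext_der.
Proof.
move=> s t; have [u ->] := extclP s; have [v ->] := extclP t.
by rewrite -raddfB !ext_derE tor_der_zmod.
Qed.
HB.instance Definition _ :=
  GRing.isZmodMorphism.Build (extTor A) Q ext_der ext_der_zmod.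

Lemma ext_der_etau m a b :
  (0 < m)%N -> abcl R a *+ m = 0 -> abcl R b *+ m = 0 ->
  ext_der (etau m (abcl R a) (abcl R b)) = beta R a b *+ m.
Proof. by move=> *; rewrite ext_derE tor_derE malg_derE. Qed.

Lemma ext_der_etauz z a b : abcl R a *~ z = 0 -> abcl R b *~ z = 0 ->
  ext_der (etauz z (abcl R a) (abcl R b)) = beta R a b *~ z.
Proof.
rewrite /etauz; case: eqP => [-> _ _|/eqP z0 /tors_abs az /tors_abs bz].
  by rewrite raddf0 mulr0z.
by rewrite raddfMz /= ext_der_etau ?absz_gt0 // pmulrn -mulrzA mulrC -intEsg.
Qed.

Lemma ext_der_reldim u :
  exists d : gsub (reldim R 3), kappa R (gval d) = ext_der u.
Proof.
have kD (d : gsub (reldim R 3)) : gval d \in lcs whole 2.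
  exact: reldim_der (gvalP d).
move: u; apply: extTor_ind => [|u v [d dE] [d' dE']|m x y m0].
- by exists 1%g; rewrite gval1 kappa1 raddf0.
- by exists (d * d')%g; rewrite gvalM kappaM ?kD // raddfD /= dE dE'.
rewrite -(ab_liftK x) -(ab_liftK y) => xm ym.
exists (GSub (cmt_reldim xm ym)).
by rewrite ext_der_etau // -(zhomX (zhom_betal _ _)).
Qed.

Lemma beta_coords (n : nat) (e : 'I_n -> F) c a b :
  coords e c a -> coords e c b ->
  beta R a b = \sum_i \sum_j beta R (e i) (e j) *~ (c i a * c j b).
Proof.
move=> ca cb; rewrite (ca _ _ (zhom_betal R b)); apply: eq_bigr => i _.
rewrite (cb _ _ (zhom_betar R (e i))) mulrz_suml; apply: eq_bigr => j _.
by rewrite -mulrzA mulrC.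
Qed.

Hypothesis freeF : free_group F.

(** Write w as a product of commutators [g_p, h_p].  Its tensor is
    N = T - T^t with T the sum of the g_p (x) h_p.  The columns of N in a
    basis (x_k) of free generators are represented by the elements r_k, which
    lie in R F' because the cocycles of free_cocycle vanish at w; a basis
    adapted to the r_k then makes d_i divide N_ij. *)
Lemma ext_der_surj w : w \in reldim R 3 -> exists u, ext_der u = kappa R w.
Proof.
have [X freeX] := freeF; move=> w3.
have [s wE] := comsub_prod (reldim_der w3).
pose g (p : gsub (@whole F) * gsub (@whole F)) : F := gval p.1.
pose h (p : gsub (@whole F) * gsub (@whole F)) : F := gval p.2.
have {}wE : w = \big[*%g/1%g]_(p <- s) cmt (g p) (h p) := wE.
pose gs := [seq g p | p <- s] ++ [seq h p | p <- s].
have gs1 p : p \in s -> g p \in gs by move=> ps; rewrite mem_cat map_f.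
have gs2 p : p \in s -> h p \in gs by move=> ps; rewrite mem_cat map_f ?orbT.
have [l [x [phi [phiM phiP]]]] := free_coords freeF gs.
pose r j := \big[*%g/1%g]_(p <- s)
  (zpow (g p) (phi j (h p)) * zpow (h p) (- phi j (g p)))%g.
have rE (U : zmodType) (f : F -> U) j : zhom f ->
    f (r j) = \sum_(p <- s) (f (g p) *~ phi j (h p) - f (h p) *~ phi j (g p)).
  move=> fM; rewrite zhom_prod //; apply: eq_bigr => p _.
  by rewrite fM !zhom_zpow // mulrNz.
have r0 j : abcl R (r j) = 0.
  have [c cM] := free_cocycle freeX abM (phiM j).
  rewrite rE; last exact: abM.
  transitivity (c w); last first.
    exact: cocycle_reldim abM (phiM j) cM (@abcl_R _ R) w3.
  rewrite wE (cocycle_prod abM cM) => [|p]; last exact: (zhom_cmt abM).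
  by apply: eq_bigr => p _; rewrite (cocycle_cmt abM cM).
pose ws := [seq r j | j <- enum 'I_l].
have ws0 v : v \in ws -> abcl R v = 0 by case/mapP => j _ ->.
have [n [e [c [d [cM cP ed dc]]]]] := adapted_coords freeF gs abM ws0.
pose E i := abcl R (e i).
pose T i j := \sum_(p <- s) c i (g p) * c j (h p).
pose N i j := T i j - T j i.
(* The coordinate c_j is a combination of the phi_k, with coefficients
   c_j(x_k). *)
have NE i j : N i j = \sum_k c i (r k) * c j (x k).
  under [RHS]eq_bigr => k _ do rewrite (rE _ _ _ (cM i)) mulr_suml.
  rewrite exchange_big /N /T -sumrB; apply: eq_big_seq => p ps /=.
  rewrite (phiP _ (gs2 p ps) _ _ (cM j)) (phiP _ (gs1 p ps) _ _ (cM j)).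
  rewrite mulr_sumr mulr_suml -sumrB; apply: eq_bigr => k _.
  rewrite mulrBl; congr (_ - _).
    by rewrite !mulrzz -!mulrA [phi _ _ * _]mulrC.
  by rewrite !mulrzz [LHS]mulrC [_ * phi _ _]mulrC mulrA.
have EN i j : E i *~ N i j = 0.
  have /dvdzP[q ->] : (d i %| N i j)%Z.
    rewrite NE; apply: rpred_sum => k _; apply: dvdz_mulr; apply: dc.
    by apply: map_f; rewrite mem_enum.
  by rewrite mulrC mulrzA ed mul0rz.
(* Antisymmetry transfers divisibility by d_i to divisibility by d_j. *)
have EN' i j : E j *~ N i j = 0.
  by rewrite -[N i j]opprB mulrNz EN oppr0.
exists (\sum_(i : 'I_n) \sum_(j : 'I_n | (i < j)%N) etauz (N i j) (E i) (E j)).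
have -> : kappa R w = \sum_i \sum_j beta R (e i) (e j) *~ T i j.
  rewrite wE kappa_prod => [|p]; last exact: cmt_der.
  transitivity (\sum_(p <- s) \sum_i \sum_j
      beta R (e i) (e j) *~ (c i (g p) * c j (h p))).
    apply: eq_big_seq => p ps.
    by apply: beta_coords; apply: cP; [exact: gs1|exact: gs2].
  rewrite exchange_big; apply: eq_bigr => i _ /=.
  by rewrite exchange_big; apply: eq_bigr => j _ /=; rewrite -mulrz_sumr.
rewrite sum_sym_pairs [X in _ = X + _]big1 ?add0r => [|i _]; last first.
  by rewrite beta_diag mul0rz.
rewrite raddf_sum; apply: eq_bigr => i _.
rewrite raddf_sum; apply: eq_bigr => j _ /=.
by rewrite ext_der_etauz ?EN ?EN' // (betaC _ (e i)) mulNrz -mulrzBr.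
Qed.

(** Modulo gamma_3(F) the product W of the [a_t^m_t, b_t] is a product of
    commutators [g_p, h_p] of elements of R.  Comparing second-order
    coefficients shows that the tensor S = T1 - T2, with T1 the sum of the
    m_t a_t (x) b_t and T2 the sum of the g_p (x) h_p, is symmetric. *)
Lemma ext_der_inj u : ext_der u = 0 -> u = 0.
Proof.
have [X freeX] := freeF.
pose wf (t : nat * F * F) :=
  [&& (0 < t.1.1)%N, abcl R t.1.2 *+ t.1.1 == 0 & abcl R t.2 *+ t.1.1 == 0].
pose m (t : {t | wf t}) := (sval t).1.1.
pose a (t : {t | wf t}) := (sval t).1.2.
pose b (t : {t | wf t}) := (sval t).2.
have m0 t : (0 < m t)%N by case: t => t; rewrite /m /= => /and3P[].
have am t : abcl R (a t) *+ m t = 0.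
  by case: t => t; rewrite /m /a /= => /and3P[_ /eqP].
have bm t : abcl R (b t) *+ m t = 0.
  by case: t => t; rewrite /m /b /= => /and3P[_ _ /eqP].
have [ts uE] : exists ts : seq {t | wf t},
    u = \sum_(t <- ts) etau (m t) (abcl R (a t)) (abcl R (b t)).
  move: u; apply: extTor_ind => [|u v [s ->] [t ->]|k x y k0 xk yk].
  - by exists [::]; rewrite big_nil.
  - by exists (s ++ t); rewrite big_cat.
  have kP : wf (k, ab_lift x, ab_lift y).
    by rewrite /wf /= k0 !ab_liftK xk yk !eqxx.
  exists [:: exist (fun t => wf t) (k, ab_lift x, ab_lift y) kP].
  by rewrite big_seq1 /m /a /b /= !ab_liftK.
pose W := \big[*%g/1%g]_(t <- ts) cmt (a t ^+ m t)%g (b t).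
have kW : ext_der u = kappa R W.
  rewrite uE raddf_sum /= kappa_prod => [|t]; last exact: cmt_der.
  by apply: eq_bigr => t _; rewrite ext_der_etau // -(zhomX (zhom_betal _ _)).
rewrite kW => /kappa_eq0; have WD : W \in lcs whole 2.
  by apply: gpred_prod => t _; apply: cmt_der.
move=> /(_ WD)/asboolP[rr [z [/comsub_prod[ps rrE] z3 Wz]]].
pose g (p : gsub R * gsub R) := gval p.1.
pose h (p : gsub R * gsub R) := gval p.2.
have {}rrE : rr = \big[*%g/1%g]_(p <- ps) cmt (g p) (h p) := rrE.
pose S (psi chi : F -> int) : int :=
  \sum_(t <- ts) (m t)%:Z * psi (a t) * chi (b t)
  - \sum_(p <- ps) psi (g p) * chi (h p).
(* Both sides of Wz are evaluated on the cocycle attached to psi and chi. *)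
have SC psi chi : zhom psi -> zhom chi -> S psi chi = S chi psi.
  move=> psiM chiM; have [c cM] := free_cocycle freeX psiM chiM.
  have cWp : c W =
      \sum_(p <- ps) (psi (g p) * chi (h p) - chi (g p) * psi (h p)).
    rewrite Wz (cocycleM0 cM) ?(cocycle_lcs3 psiM chiM cM z3) ?addr0;
      last first.
      by rewrite rrE zhom_prod // big1 // => p _; apply: zhom_cmt.
    rewrite rrE (cocycle_prod psiM cM) => [|p]; last exact: zhom_cmt.
    apply: eq_bigr => p _; rewrite (cocycle_cmt psiM cM) !mulrzz.
    by rewrite [psi (h p) * _]mulrC.
  have cWt : c W = \sum_(t <- ts)
      ((m t)%:Z * psi (a t) * chi (b t) - (m t)%:Z * chi (a t) * psi (b t)).
    rewrite (cocycle_prod psiM cM) => [|t]; last exact: zhom_cmt.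
    apply: eq_bigr => t _; rewrite (cocycle_cmt psiM cM) !mulrzz !zhomX //.
    rewrite !pmulrn !mulrzz [psi (b t) * _]mulrC.
    by rewrite [psi (a t) * _]mulrC [chi (a t) * _]mulrC.
  move: cWp; rewrite cWt !sumrB => key.
  by rewrite /S (canRL (subrK _) key) addrC !addrA addNr add0r addrC.
pose ws := [seq (a t ^+ m t)%g | t <- ts] ++ [seq (b t ^+ m t)%g | t <- ts]
  ++ [seq g p | p <- ps] ++ [seq h p | p <- ps].
pose gs := [seq a t | t <- ts] ++ [seq b t | t <- ts].
have ws0 v : v \in ws -> abcl R v = 0.
  rewrite !mem_cat => /or4P[] /mapP[i _ ->].
  - by rewrite (zhomX abM).
  - by rewrite (zhomX abM).
  - by apply: abcl_R; apply: gvalP.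
  - by apply: abcl_R; apply: gvalP.
have [n [e [c [d [cM cP ed dc]]]]] := adapted_coords freeF gs abM ws0.
pose E i := abcl R (e i).
have Ew i v : v \in ws -> E i *~ c i v = 0.
  by move=> /(dc i)/dvdzP[q ->]; rewrite mulrC mulrzA ed mul0rz.
have Ea i t : t \in ts -> E i *~ ((m t)%:Z * c i (a t)) = 0.
  move=> tts; rewrite mulrC -[_ * _%:Z]mulrzz -pmulrn -(zhomX (cM i)).
  apply: Ew.
  by rewrite !mem_cat (map_f (fun t => (a t ^+ m t)%g)).
have Eb i t : t \in ts -> E i *~ ((m t)%:Z * c i (b t)) = 0.
  move=> tts; rewrite mulrC -[_ * _%:Z]mulrzz -pmulrn -(zhomX (cM i)).
  apply: Ew.
  by rewrite !mem_cat (map_f (fun t => (b t ^+ m t)%g)) // orbT.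
have Eg i p : p \in ps -> E i *~ c i (g p) = 0.
  by move=> pps; apply: Ew; rewrite !mem_cat (map_f g) ?orbT.
have Eh i p : p \in ps -> E i *~ c i (h p) = 0.
  by move=> pps; apply: Ew; rewrite !mem_cat (map_f h) ?orbT.
have kill (x : A) (y z' : int) : x *~ y = 0 -> x *~ (y * z') = 0.
  by move=> xy; rewrite mulrzA xy mul0rz.
pose T1 i j := \sum_(t <- ts) (m t)%:Z * c i (a t) * c j (b t).
pose T2 i j := \sum_(p <- ps) c i (g p) * c j (h p).
have E1 i j t : t \in ts -> E i *~ ((m t)%:Z * c i (a t) * c j (b t)) = 0.
  by move=> tts; apply/kill/Ea.
have E1' i j t : t \in ts -> E j *~ ((m t)%:Z * c i (a t) * c j (b t)) = 0.
  by move=> tts; rewrite mulrAC; apply/kill/Eb.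
have E2 i j p : p \in ps -> E i *~ (c i (g p) * c j (h p)) = 0.
  by move=> pps; apply/kill/Eg.
have E2' i j p : p \in ps -> E j *~ (c i (g p) * c j (h p)) = 0.
  by move=> pps; rewrite mulrC; apply/kill/Eh.
have sum0 (I : eqType) (s : seq I) (Z : I -> int) (x : A) :
    (forall i, i \in s -> x *~ Z i = 0) -> x *~ (\sum_(i <- s) Z i) = 0.
  by move=> xZ; rewrite mulrz_sumr big1_seq // => i /xZ.
(* The powers of the a_t and b_t are in ws, so the expansion of each symbol in
   coordinates is legitimate. *)
have uT : u = \sum_i \sum_j etauz (T1 i j) (E i) (E j).
  rewrite uE; transitivity (\sum_(t <- ts) \sum_i \sum_j
      etauz ((m t)%:Z * c i (a t) * c j (b t)) (E i) (E j)).
    apply: eq_big_seq => t tts.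
    have ag : a t \in gs by rewrite mem_cat map_f.
    have bg : b t \in gs by rewrite mem_cat map_f ?orbT.
    rewrite (cP _ ag _ _ abM) (cP _ bg _ _ abM) etau_coords // => i.
      exact: Ea.
    exact: Eb.
  rewrite exchange_big; apply: eq_bigr => i _ /=.
  rewrite exchange_big; apply: eq_bigr => j _ /=.
  by rewrite -etauz_sum // => t tts; [exact: E1|exact: E1'].
rewrite uT -[RHS](@etauz_sym0 _ n E (fun i j => S (c i) (c j))) => [|i j|i j].
- apply: eq_bigr => i _; apply: eq_bigr => j _.
  rewrite [S _ _]/(T1 i j - T2 i j) etauzD ?mulrNz ?sum0 ?oppr0 //;
    try by [exact: E1|exact: E1'|exact: E2|exact: E2'].
  rewrite etauzN [etauz (T2 i j) _ _]etauz_sum => [|p pps|p pps];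
    [|exact: E2|exact: E2'].
  rewrite big1_seq ?oppr0 ?addr0 // => p /= pps.
  by apply: etauz_tors; [exact: Eg|exact: Eh].
- by apply: SC.
rewrite [S _ _]/(T1 i j - T2 i j) mulrzBr !sum0 ?subrr // => k ks.
  exact: E2.
exact: E1.
Qed.

End Comparison.

(** * The isomorphism *)

Section Isomorphism.
Variables (F : groupType) (R : normalClosed F).

(** F'/R' gamma_3(F) contains D_3(F,R)/R' gamma_3(F), and the comparison map
    takes its values there; dim_iso is its corestriction. *)
Definition dim_iso (u : extTor (relab R)) : dimquo R :=
  dimcl (projT1 (cid (ext_der_reldim u))).

Lemma dimclM (d d' : gsub (reldim R 3)) :
  dimcl (d * d')%g = (dimcl d * dimcl d')%g.
Proof. exact: (coset_gmulfM (relsub (mulsub (lcs R 2) (lcs whole 3)))). Qed.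

Lemma dimcl_kappa (d d' : gsub (reldim R 3)) :
  dimcl d = dimcl d' <-> kappa R (gval d) = kappa R (gval d').
Proof.
have dD (d1 : gsub (reldim R 3)) : gval d1 \in lcs whole 2.
  exact: reldim_der (gvalP d1).
have VD : (gval d)^-1%g \in lcs whole 2 by rewrite gpredV.
rewrite (_ : (_ = _ :> derquo R) <-> (gval d)^-1 * gval d' \in
    mulsub (lcs R 2) (lcs whole 3))%g; first exact: sqcl_eq.
rewrite -kappa_eq0; last exact: gpredM.
rewrite kappaM // kappaV // addrC.
by split=> [->|/eqP]; rewrite ?subrr // subr_eq0 => /eqP.
Qed.

Lemma dim_isoE u d : dim_iso u = dimcl d <-> ext_der u = kappa R (gval d).
Proof. by rewrite dimcl_kappa; case: cid => /= d' ->. Qed.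

Lemma dim_isoP u :
  exists2 d, dim_iso u = dimcl d & ext_der u = kappa R (gval d).
Proof. by have [d dE] := ext_der_reldim u; exists d => //; apply/dim_isoE. Qed.

Lemma dim_isoD u v : dim_iso (u + v) = (dim_iso u * dim_iso v)%g.
Proof.
have [d du uE] := dim_isoP u; have [d' dv vE] := dim_isoP v.
rewrite du dv -dimclM; apply/dim_isoE.
rewrite gvalM kappaM; first by rewrite raddfD /= uE vE.
  exact: reldim_der (gvalP _).
exact: reldim_der (gvalP _).
Qed.

Lemma dim_iso_bij : free_group F -> bijective dim_iso.
Proof.
move=> freeF.
have inj : injective dim_iso.
  move=> u v; have [d -> uE] := dim_isoP u; have [d' -> vE] := dim_isoP v.
  move=> /dimcl_kappa; rewrite -uE -vE => uv.
  apply/eqP; rewrite -subr_eq0; apply/eqP/(ext_der_inj freeF).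
  by rewrite raddfB /= uv subrr.
have /choice[inv invP] : forall q : dimquo R, exists u, dim_iso u = q.
  move=> q; have [d ->] := cosetP q.
  have [u uE] := ext_der_surj freeF (gvalP d).
  by exists u; apply/dim_isoE.
by exists inv => // u; apply: inj.
Qed.

End Isomorphism.

HB.instance Definition _ (A B : zmodType) (f : {additive A -> B}) :=
  GRing.isZmodMorphism.Build (extTor A) (extTor B) (ext_map f) (ext_map_zmod f).

(** The induction carries along a representative d of the image of u, because
    dimquo_map is computed on representatives. *)
Lemma dim_iso_natural (F G : groupType) (R : normalClosed F)
    (S : normalClosed G) (phi : {multiplicative F -> G})
    (h : pair_morphism phi R S) (u : extTor (relab R)) :
  dim_iso (ext_map (relab_map h) u) = dimquo_map h (dim_iso u).
Proof.
pose P u := exists d : gsub (reldim R 3), ext_der u = kappa R (gval d) /\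
  ext_der (ext_map (relab_map h) u) = kappa S (phi (gval d)).
have [d [/dim_isoE -> /= uE]] : P u; last first.
  by rewrite dimquo_mapE; apply/dim_isoE.
have dD (d : gsub (reldim R 3)) : gval d \in lcs whole 2.
  exact: reldim_der (gvalP d).
have pD (d : gsub (reldim R 3)) : phi (gval d) \in lcs whole 2.
  exact: (@mult_lcs _ _ phi whole).
move: u; apply: extTor_ind => [|v w [d [vd vd']] [d' [wd wd']]|m x y m0].
- exists 1%g; rewrite !raddf0 gval1 mult1.
  by rewrite !kappa1.
- exists (d * d')%g.
  by rewrite gvalM gmulfM !kappaM // !raddfD /= vd vd' wd wd'.
rewrite -(ab_liftK x) -(ab_liftK y) => xm ym.
exists (GSub (cmt_reldim xm ym)); rewrite /= ext_der_etau //; split.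
  by rewrite -(zhomX (zhom_betal _ _)).
have xm' := f_tors (relab_map h) xm; have ym' := f_tors (relab_map h) ym.
rewrite /= !relab_mapE in xm' ym'.
rewrite [etau _ _ _]/(extcl _) ext_mapE tor_map_tau //= !relab_mapE.
rewrite -[extcl _]/(etau _ _ _) ext_der_etau // -(zhomX (zhom_betal _ _)).
have phiX n : phi (ab_lift x ^+ n)%g = (phi (ab_lift x) ^+ n)%g.
  by elim: n => [|n IHn]; rewrite ?mult1 // !expgS gmulfM IHn.
by rewrite /beta /cmt !gmulfM !multV phiX.
Qed.

Theorem theorem3p3 :
  exists theta : forall (F : groupType) (R : normalClosed F), free_group F ->
      extTor (relab R) -> dimquo R,
    [/\ forall (F : groupType) (R : normalClosed F) (hF : free_group F)
          (m : nat) (x y : relab R) (a b : F),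
          (0 < m)%N -> x *+ m = 0 -> y *+ m = 0 ->
          abcl R a = x -> abcl R b = y ->
          exists d : gsub (reldim R 3),
            gval d = cmt (a ^+ m)%g b /\
            theta F R hF (extcl (tau m x y)) = dimcl d,
        forall (F : groupType) (R : normalClosed F) (hF : free_group F)
          (u v : extTor (relab R)),
          theta F R hF (u + v) = (theta F R hF u * theta F R hF v)%g,
        forall (F : groupType) (R : normalClosed F) (hF : free_group F),
          bijective (theta F R hF)
      & forall (F G : groupType) (R : normalClosed F) (S : normalClosed G)
          (hF : free_group F) (hG : free_group G)
          (phi : {multiplicative F -> G}) (h : pair_morphism phi R S)
          (u : extTor (relab R)),
          theta G S hG (ext_map (relab_map h) u) =
            dimquo_map h (theta F R hF u)].
Proof.
exists (fun F R _ => @dim_iso F R); split.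
- move=> F R _ m x y a b m0 xm ym ax bx; subst x y.
  exists (GSub (cmt_reldim xm ym)); split=> //; apply/dim_isoE.
  by rewrite ext_der_etau //= -(zhomX (zhom_betal _ _)).
- by move=> F R _; apply: dim_isoD.
- by move=> F R; apply: dim_iso_bij.
by move=> F G R S _ _ phi h u; apply: dim_iso_natural.
Qed.
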